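(* Let $\omega$ be a non-principal ultrafilter on $\mathbb N$ and let $\big(\{(X_i,d_i,\mathfrak m_i,p_i)\}_{i\in\mathbb N},\{\varphi_{ij}\}_{i\le j}\big)$ be a direct system of pointed Polish metric measure spaces. Then the direct system admits a direct limit $(X,d_X,\mathfrak m_X,p_X)$ (in the category of pointed Polish metric measure spaces) if and only if the sequence $\big((X_i,d_i,\mathfrak m_i,p_i)\big)$ is $\omega$-uniformly boundedly finite. In this case, $$(X,d_X,\mathfrak m_X,p_X)=\big({\rm spt}(\mathfrak m_\omega),\,d_\omega|_{{\rm spt}(\mathfrak m_\omega)\times{\rm spt}(\mathfrak m_\omega)},\,\mathfrak m_\omega|_{\mathscr B({\rm spt}(\mathfrak m_\omega))},\,p_\omega\big),$$ where $(X_\omega,d_\omega,\mathfrak m_\omega,p_\omega)=\lim_{i\to\omega}(X_i,d_i,\mathfrak m_i,p_i)$ is the ultralimit and $\mathscr B$ denotes the Borel $\sigma$-algebra.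
   Context: In this statement, a pointed Polish metric measure space $(X,d,\mathfrak m,p)$ is a complete separable metric space with a Borel measure $\mathfrak m$ finite on balls and a point $p\in{\rm spt}(\mathfrak m)$, where ${\rm spt}(\mathfrak m):=\{x:\mathfrak m(B(x,r))>0\ \forall r>0\}$ and $B(x,r)$ is the open ball. A morphism $\varphi\colon(X,d_X,\mathfrak m_X,p_X)\to(Y,d_Y,\mathfrak m_Y,p_Y)$ is a Borel map $\varphi\colon X\to Y$ with $\varphi(p_X)=p_Y$, with $\varphi|_{{\rm spt}(\mathfrak m_X)}$ $1$-Lipschitz, and with $\varphi_*\mathfrak m_X\le\mathfrak m_Y$. The isomorphisms are the morphisms $\varphi$ such that $\varphi|_{{\rm spt}(\mathfrak m_X)}$ is an isometry and $\varphi_*\mathfrak m_X=\mathfrak m_Y$. Direct system: morphisms $\varphi_{ij}\colon X_i\to X_j$ ($i\le j$) with $\varphi_{ii}={\rm id}_{X_i}$ and $\varphi_{ik}=\varphi_{jk}\circ\varphi_{ij}$ for $i\le j\le k$. A target is a pointed Polish metric measure space $Y$ with morphisms $\psi_i\colon X_i\to Y$ such that $\psi_i=\psi_j\circ\varphi_{ij}$ for $i\le j$. A direct limit is a target $(X,\{\varphi_i\})$ such that for every target $(Y,\{\psi_i\})$ there is a unique morphism $\Phi\colon X\to Y$ with $\psi_i=\Phi\circ\varphi_i$ for all $i$. Whenever it exists, the direct limit is determined up to unique isomorphism, and the equality in the claim is understood in this sense. $\omega$-uniformly boundedly finite: for every $R>0$ there is $\eta(R)<+\infty$ with $\mathfrak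 m_i(B(p_i,R))\le\eta(R)$ for $\omega$-a.e. $i$ (i.e. for all $i$ in some element of $\omega$). Ultralimit $(X_\omega,d_\omega,\mathfrak m_\omega,p_\omega)$. For a metric space, ${\rm Ball}(\cdot)$ is the $\sigma$-algebra generated by open balls (Borel if separable). Let $\bar X_\omega$ be the set of families $(x_i)_{i\in S}$, $S\in\omega$, $x_i\in X_i$, modulo equality for $\omega$-a.e. $i$ (classes $[x_i]$); $\bar d_\omega([x_i],[y_i]):=\lim_{i\to\omega}d_i(x_i,y_i)$; $O(\bar X_\omega):=\{[x_i]:\bar d_\omega([x_i],[p_i])<+\infty\}$. $X_\omega$ is the quotient of $O(\bar X_\omega)$ by $\bar d_\omega=0$, with classes $[[x_i]]$, induced distance $d_\omega$, projection $\pi$, and $p_\omega:=[[p_i]]$. For $S\in\omega$, $A_i\in{\rm Ball}(X_i)$, $i\in S$, let $\Pi_{i\to\omega}A_i:=\{[x_i]\in\bar X_\omega:x_i\in A_i\text{ for }\omega\text{-a.e. }i\}$; $\mathcal A_O(\bar X_\omega)$ is the algebra of all sets $(\Pi_{i\to\omega}A_i)\cap O(\bar X_\omega)$, and $\bar{\mathfrak m}_\omega\big((\Pi_{i\to\omega}A_i)\cap O(\bar X_\omega)\big):=\lim_{R\to\infty}\lim_{i\to\omega}\mathfrak m_i(A_i\cap B(p_i,R))$. $N\subset O(\bar X_\omega)$ is null ($N\in\mathcal N_\omega$) if for every $\varepsilon>0$ there is $\bar A\in\mathcal A_O(\bar X_\omega)$ with $N\subset\bar A$, $\bar{\mathfrak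 m}_\omega(\bar A)<\varepsilon$. $\bar{\mathcal B}_\omega$ is the family of $A\subset O(\bar X_\omega)$ such that for every $R>0$ there is $\bar A_R\in\mathcal A_O(\bar X_\omega)$ with $(A\cap\Pi_{i\to\omega}B(p_i,R))\Delta\bar A_R\in\mathcal N_\omega$; for such $A$, $\bar{\mathfrak m}_\omega(A):=\lim_{R\to\infty}\bar{\mathfrak m}_\omega(\bar A_R)$. Under $\omega$-uniform bounded finiteness, $\bar{\mathcal B}_\omega$ is a $\sigma$-algebra, $\bar{\mathfrak m}_\omega$ a measure on it, $\pi^{-1}(A)\in\bar{\mathcal B}_\omega$ for $A\in{\rm Ball}(X_\omega)$, and $\mathfrak m_\omega(A):=\bar{\mathfrak m}_\omega(\pi^{-1}(A))$ for $A\in{\rm Ball}(X_\omega)$. ${\rm spt}(\mathfrak m_\omega)$ is closed and separable, and its Borel subsets belong to ${\rm Ball}(X_\omega)$.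
   Formalization: Equalities of morphisms (in direct systems, targets, the factorization and the uniqueness of Φ) are read as agreement on the support of the source space; with equality everywhere the existence claim fails, e.g. for shifts on a null Cantor set. *)

(* Defs.v *)
From HB Require Import structures.
From mathcomp Require Import all_boot all_order all_algebra generic_quotient.
From mathcomp Require Import all_classical all_reals all_analysis.

Set Implicit Arguments.
Unset Strict Implicit.
Unset Printing Implicit Defensive.

Import Order.TTheory GRing.Theory Num.Theory.
Import numFieldNormedType.Exports.

Local Open Scope classical_set_scope.
Local Open Scope ring_scope.
Local Open Scope quotient_scope.

#[short(type="completeMetricType")]
HB.structure Definition CompleteMetric (K : numDomainType) :=
  {T of Complete T & Metric K T}.

Notation borel T := (g_sigma_algebraType (@open T)).

(* [ball x r] is the open ball [[set y | mdist x y < r]], see [ballEmdist] *)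
Definition spt (R : realType) (T : metricType R) (m : set T -> \bar R) : set T :=
  [set x | forall r : R, 0 < r -> (0 < m (ball x r))%E].

(* the base point is the distinguished element [point] of the carrier *)
Record ppmms (R : realType) := PPMMS {
  space :> completeMetricType R ;
  meas : {measure set (borel space) -> \bar R} ;
  ppmms_separable : exists2 D : set space, countable D & dense D ;
  ppmms_finite : forall (x : space) (r : R), (meas (ball x r) < +oo)%E ;
  ppmms_point : spt (meas : set space -> \bar R) point
}.
Arguments meas {R} p.

Definition sptm (R : realType) (X : ppmms R) : set X :=
  spt (meas X : set X -> \bar R).
Arguments sptm {R} X.

Record is_morphism (R : realType) (X Y : ppmms R) (f : X -> Y) : Prop := {
  morphism_borel : measurable_fun [set: borel X] (f : borel X -> borel Y) ;
  morphism_point : f point = point ;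
  morphism_lip : forall x y, sptm X x -> sptm X y ->
    mdist (f x) (f y) <= mdist x y ;
  morphism_push : forall A : set (borel Y), measurable A ->
    (pushforward (meas X) (f : borel X -> borel Y) A <= meas Y A)%E
}.

(* Morphisms are considered up to their values outside the support: this is   *)
(* the equality of arrows for which the isomorphisms of the category are the  *)
(* maps satisfying [is_isomorphism] below (a bijection between whole carriers *)
(* is not required), and the one for which direct limits are unique up to     *)
(* unique isomorphism. Since morphisms map supports into supports, it is      *)
(* compatible with composition.                                               *)
Definition eq_mor (R : realType) (X Y : ppmms R) (f g : X -> Y) : Prop :=
  forall x, sptm X x -> f x = g x.

Definition is_isomorphism (R : realType) (X Y : ppmms R) (f : X -> Y) : Prop :=
  [/\ is_morphism f,
      forall x y, sptm X x -> sptm X y -> mdist (f x) (f y) = mdist x y &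
      forall A : set (borel Y), measurable A ->
        pushforward (meas X) (f : borel X -> borel Y) A = meas Y A].

Section direct_systems.
Context (R : realType) (X : nat -> ppmms R).
(* only the maps [phi i j] with [i <= j] are relevant *)
Context (phi : forall i j, X i -> X j).

Definition is_direct_system : Prop :=
  [/\ forall i j, (i <= j)%N -> is_morphism (@phi i j),
      forall i, eq_mor (@phi i i) id &
      forall i j k, (i <= j)%N -> (j <= k)%N ->
        eq_mor (@phi i k) (@phi j k \o @phi i j)].

Definition is_target (Y : ppmms R) (psi : forall i, X i -> Y) : Prop :=
  (forall i, is_morphism (psi i)) /\
  (forall i j, (i <= j)%N -> eq_mor (psi i) (psi j \o @phi i j)).

Definition is_direct_limit (Z : ppmms R) (f : forall i, X i -> Z) : Prop :=
  is_target f /\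
  forall (Y : ppmms R) (psi : forall i, X i -> Y), is_target psi ->
    exists Phi : Z -> Y,
      [/\ is_morphism Phi,
          forall i, eq_mor (psi i) (Phi \o f i) &
          forall Phi' : Z -> Y, is_morphism Phi' ->
            (forall i, eq_mor (psi i) (Phi' \o f i)) -> eq_mor Phi' Phi].

End direct_systems.

Definition nonprincipal (omega : set_system nat) : Prop :=
  forall n, ~ omega [set n].

Definition unif_bdd_finite (R : realType) (omega : set_system nat)
    (X : nat -> ppmms R) : Prop :=
  forall r : R, 0 < r -> exists eta : R,
    \forall i \near omega, (meas (X i) (ball (point : X i) r) <= eta%:E)%E.

Section ultrafilter_limits.
Context (R : realType) (omega : set_system nat) {Uomega : UltraFilter omega}.

Lemma ultra_cvg_ereal (u : nat -> \bar R) : cvg (u @ omega).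
Proof.
pose S := [set a | \forall i \near omega, (a <= u i)%E].
apply/cvg_ex; exists (ereal_sup S).
have lo a : (a < ereal_sup S)%E -> \forall i \near omega, (a < u i)%E.
  move=> /ereal_sup_gt[b Sb ab]; near=> i.
  by apply: (lt_le_trans ab); near: i.
have hi a : (ereal_sup S < a)%E -> \forall i \near omega, (u i < a)%E.
  move=> Sa; have [aS|] := in_ultra_setVsetC [set i | (a <= u i)%E] Uomega.
    have : (a <= ereal_sup S)%E by exact: ereal_sup_ubound.
    by rewrite leNgt Sa.
  by apply: filterS => i /= /negP; rewrite -ltNge.
move: (ereal_sup S) lo hi => [l||] lo hi A.
- case=> e /= e0 eA.
  have l1 : ((l - e)%:E < l%:E)%E by rewrite lte_fin ltrBlDr ltrDl.
  have l2 : (l%:E < (l + e)%:E)%E by rewrite lte_fin ltrDl.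
  apply: filterS2 (lo _ l1) (hi _ l2) => i /=; case: (u i) => // r.
  rewrite !lte_fin => h1 h2; apply: (eA r).
  by rewrite /ball_/= distrC ltr_distl; apply/andP.
- case=> M [Mr MA]; apply: filterS (lo M%:E _); last by rewrite ltry.
  by move=> i; exact: MA.
- case=> M [Mr MA]; apply: filterS (hi M%:E _); last by rewrite ltNyr.
  by move=> i; exact: MA.
Unshelve. all: by end_near. Qed.

Lemma ultra_lim_eq (u v : nat -> \bar R) :
  (\forall i \near omega, u i = v i) -> lim (u @ omega) = lim (v @ omega).
Proof.
move=> uv; apply/cvg_lim => //; apply: cvg_trans (@ultra_cvg_ereal v).
by apply: near_eq_cvg; apply: filterS uv => i ->.
Qed.

Lemma ultra_lim_le (u v : nat -> \bar R) :
  (\forall i \near omega, (u i <= v i)%E) ->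
  (lim (u @ omega) <= lim (v @ omega))%E.
Proof. by move=> uv; apply: lee_lim => //; exact: ultra_cvg_ereal. Qed.

Lemma ultra_lim_ge0 (u : nat -> \bar R) :
  (forall i, (0 <= u i)%E) -> (0 <= lim (u @ omega))%E.
Proof.
by move=> u0; apply: lime_ge; [exact: ultra_cvg_ereal|exact: nearW].
Qed.

Lemma ultra_limD (u v : nat -> \bar R) :
  (forall i, (0 <= u i)%E) -> (forall i, (0 <= v i)%E) ->
  lim ((fun i => u i + v i)%E @ omega)
    = (lim (u @ omega) + lim (v @ omega))%E.
Proof.
move=> u0 v0; apply/cvg_lim => //; apply: cvgeD; try exact: ultra_cvg_ereal.
by apply: ge0_adde_def; rewrite inE; exact: ultra_lim_ge0.
Qed.

End ultrafilter_limits.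

Section ultralimit_space.
Context (R : realType) (omega : set_system nat) {Uomega : UltraFilter omega}.
Context (X : nat -> ppmms R).

(* As every [X i] has a base point, a family defined on an element of [omega] *)
(* always extends to the whole of [nat], so total families suffice.           *)
Definition eqfam (x y : forall i, X i) : bool :=
  `[< \forall i \near omega, x i = y i >].

Lemma eqfam_refl : reflexive eqfam.
Proof. by move=> x; apply/asboolP; exact: nearW. Qed.

Lemma eqfam_sym : symmetric eqfam.
Proof.
by move=> x y; apply/asboolP/asboolP; apply: filterS => i ->.
Qed.

Lemma eqfam_trans : transitive eqfam.
Proof.
move=> y x z /asboolP xy /asboolP yz; apply/asboolP.
by apply: filterS2 xy yz => i -> ->.
Qed.

Canonical eqfam_equiv := EquivRel eqfam eqfam_refl eqfam_sym eqfam_trans.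

Definition ubar := {eq_quot eqfam_equiv}.

HB.instance Definition _ := Choice.on ubar.
HB.instance Definition _ := EqQuotient.on ubar.

Definition famdist (x y : forall i, X i) : \bar R :=
  lim ((fun i => (mdist (x i) (y i))%:E) @ omega).

Definition dbar (a b : ubar) : \bar R := famdist (repr a) (repr b).

Lemma dbarE (x y : forall i, X i) :
  dbar (\pi_ubar x) (\pi_ubar y) = famdist x y.
Proof.
have reprP z : \forall i \near omega, repr (\pi_ubar z) i = z i.
  by apply/asboolP/(@eqmodP _ eqfam_equiv); rewrite reprK.
apply: ultra_lim_eq.
by apply: filterS2 (reprP x) (reprP y) => i -> ->.
Qed.

Lemma dbar_ge0 a b : (0 <= dbar a b)%E.
Proof. by apply: ultra_lim_ge0 => i; rewrite lee_fin mdist_ge0. Qed.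

Lemma dbarxx a : dbar a a = 0%E.
Proof.
rewrite /dbar /famdist.
under eq_fun do rewrite mdistxx.
exact: lim_cst.
Qed.

Lemma dbar_sym a b : dbar a b = dbar b a.
Proof. by apply: ultra_lim_eq; apply: nearW => i; rewrite metric_sym. Qed.

Lemma dbar_triangle b a c : (dbar a c <= dbar a b + dbar b c)%E.
Proof.
rewrite /dbar /famdist -ultra_limD; first last.
- by move=> i; rewrite lee_fin mdist_ge0.
- by move=> i; rewrite lee_fin mdist_ge0.
apply: ultra_lim_le; apply: nearW => i.
by rewrite -EFinD lee_fin metric_triangle.
Qed.

Definition ubar_pt : ubar := \pi_ubar (fun i => point).

Definition Obar : set ubar := [set a | (dbar a ubar_pt < +oo)%E].

Definition Otype : Type := {a : ubar | a \in Obar}.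

HB.instance Definition _ := Choice.on Otype.

Definition eqO (a b : Otype) : bool := dbar (val a) (val b) == 0%E.

Lemma eqO_refl : reflexive eqO.
Proof. by move=> a; rewrite /eqO dbarxx. Qed.

Lemma eqO_sym : symmetric eqO.
Proof. by move=> a b; rewrite /eqO dbar_sym. Qed.

Lemma eqO_trans : transitive eqO.
Proof.
move=> b a c /eqP ab /eqP bc; apply/eqP/le_anti; rewrite dbar_ge0 andbT.
by rewrite (le_trans (dbar_triangle (val b) _ _))// ab bc adde0.
Qed.

Canonical eqO_equiv := EquivRel eqO eqO_refl eqO_sym eqO_trans.

Definition ultralim := {eq_quot eqO_equiv}.

HB.instance Definition _ := Choice.on ultralim.
HB.instance Definition _ := EqQuotient.on ultralim.

Definition dist_ultralim (x y : ultralim) : R :=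
  fine (dbar (val (repr x)) (val (repr y))).

Lemma Obar_fin_num (a b : Otype) : dbar (val a) (val b) \is a fin_num.
Proof.
rewrite ge0_fin_numE ?dbar_ge0//.
rewrite (le_lt_trans (dbar_triangle ubar_pt _ _))//.
have Oc (c : Otype) : (dbar (val c) ubar_pt < +oo)%E.
  exact: set_mem (svalP c).
by apply: lte_add_pinfty; [|rewrite dbar_sym]; exact: Oc.
Qed.

Lemma dist_ultralimE (a b : Otype) :
  (dist_ultralim (\pi_ultralim a) (\pi_ultralim b))%:E = dbar (val a) (val b).
Proof.
have reprP c : dbar (val (repr (\pi_ultralim c))) (val c) = 0%E.
  by apply/eqP/(@eqmodP _ eqO_equiv); rewrite reprK.
rewrite /dist_ultralim fineK ?Obar_fin_num//; apply/le_anti/andP; split.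
  rewrite (le_trans (dbar_triangle (val a) _ _))// reprP add0e.
  by rewrite (le_trans (dbar_triangle (val b) _ _))// (dbar_sym (val b)) reprP adde0.
set a' := repr _; set b' := repr _.
rewrite (le_trans (dbar_triangle (val a') _ _))// (dbar_sym (val a)) reprP add0e.
by rewrite (le_trans (dbar_triangle (val b') _ _))// reprP adde0.
Qed.

Lemma dist_ultralimxx x : dist_ultralim x x = 0.
Proof. by rewrite /dist_ultralim dbarxx. Qed.

Lemma dist_ultralim_positivity x y : dist_ultralim x y = 0 -> x = y.
Proof.
move=> xy0; rewrite -[x]reprK -[y]reprK; apply/(@eqmodP _ eqO_equiv)/eqP.
by rewrite -dist_ultralimE !reprK xy0.
Qed.

Lemma dist_ultralim_sym x y : dist_ultralim x y = dist_ultralim y x.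
Proof. by rewrite /dist_ultralim dbar_sym. Qed.

Lemma dist_ultralim_triangle y x z :
  dist_ultralim x z <= dist_ultralim x y + dist_ultralim y z.
Proof.
rewrite -lee_fin EFinD /dist_ultralim !fineK ?Obar_fin_num//.
exact: dbar_triangle.
Qed.

HB.instance Definition _ := isMetric.Build R ultralim dist_ultralimxx
  dist_ultralim_positivity dist_ultralim_sym dist_ultralim_triangle.

Lemma ubar_ptP : ubar_pt \in Obar.
Proof. by apply/mem_set; rewrite /Obar/= dbarxx ltry. Qed.

Definition ultralim_pt : ultralim := \pi_ultralim (exist _ ubar_pt ubar_ptP).

End ultralimit_space.

Arguments ubar {R} omega {Uomega} X.
Arguments ubar_pt {R} omega {Uomega} X.
Arguments Obar {R} omega {Uomega} X.
Arguments Otype {R} omega {Uomega} X.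
Arguments ultralim {R} omega {Uomega} X.
Arguments ultralim_pt {R} omega {Uomega} X.

Definition ball_algebra (R : realType) (T : metricType R) : set (set T) :=
  <<s [set B : set T | exists (x : T) (r : R), 0 < r /\ B = ball x r] >>.

Section ultralimit_measure.
Context (R : realType) (omega : set_system nat) {Uomega : UltraFilter omega}.
Context (X : nat -> ppmms R).

Definition ball_family (A : forall i, set (X i)) : Prop :=
  \forall i \near omega, ball_algebra (A i).

Definition uprod (A : forall i, set (X i)) : set (ubar omega X) :=
  [set a | \forall i \near omega, A i (repr a i)].

Lemma uprodE (A : forall i, set (X i)) (x : forall i, X i) :
  uprod A (\pi_(ubar omega X) x) <-> \forall i \near omega, A i (x i).
Proof.
have reprP : \forall i \near omega, repr (\pi_(ubar omega X) x) i = x i.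
  by apply/asboolP/(@eqmodP _ (eqfam_equiv (omega := omega) X)); rewrite reprK.
by split; apply: filterS2 reprP => i ->.
Qed.

Definition algO : set (set (ubar omega X)) :=
  [set E | exists2 A, ball_family A & E = uprod A `&` Obar omega X].

Definition fam_vol (A : forall i, set (X i)) : \bar R :=
  lim ((fun r : R =>
    lim ((fun i => meas (X i) (A i `&` ball (point : X i) r)) @ omega)) @ +oo).

(* the volume does not depend on the choice of [A], see [mbar0E] *)
Definition mbar0 (E : set (ubar omega X)) : \bar R :=
  get [set v | exists A, [/\ ball_family A,
                             E = uprod A `&` Obar omega X & v = fam_vol A]].

Let uprod_ball (A B : forall i, set (X i)) (r : R) :
  uprod A `&` Obar omega X `<=` uprod B `&` Obar omega X ->
  \forall i \near omega,
    A i `&` ball (point : X i) r `<=` B i `&` ball (point : X i) r.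
Proof.
move=> AB.
pose P := [set i | A i `&` ball (point : X i) r `<=` B i `&` ball (point : X i) r].
have [//|nP] := in_ultra_setVsetC P Uomega.
have ex i : exists x : X i, ~ P i -> (A i `&` ball point r) x /\ ~ B i x.
  have [Pi|nPi] := pselect (P i); first by exists point.
  suff [x [Abx nBx]] : exists x, (A i `&` ball point r) x /\ ~ B i x by exists x.
  apply: contrapT => nex; apply: nPi => x [Ax bx]; split => //.
  by apply: contrapT => nBx; apply: nex; exists x.
pose x i := projT1 (cid (ex i)).
have xP i : ~ P i -> (A i `&` ball point r) (x i) /\ ~ B i (x i).
  exact: projT2 (cid (ex i)).
have Ax : uprod A (\pi_(ubar omega X) x).
  by apply/uprodE; apply: filterS nP => i /xP[[]].
have Ox : Obar omega X (\pi_(ubar omega X) x).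
  rewrite /Obar /= dbarE; apply: (@le_lt_trans _ _ r%:E); last exact: ltry.
  apply: lime_le; first exact: ultra_cvg_ereal.
  apply: filterS nP => i /xP[[_ +] _].
  by rewrite ballEmdist lee_fin metric_sym => /ltW.
have [/uprodE Bx _] := AB _ (conj Ax Ox).
have : omega set0 by apply: filterS2 Bx nP => i Bxi /xP[].
by move/filter_ex => [].
Qed.

Lemma mbar0E (A : forall i, set (X i)) :
  ball_family A -> mbar0 (uprod A `&` Obar omega X) = fam_vol A.
Proof.
move=> bA; rewrite /mbar0; apply: get_unique; first by exists A.
move=> v [B [_ AB ->]]; rewrite /fam_vol.
have volE r : lim ((fun i => meas (X i) (B i `&` ball (point : X i) r)) @ omega)
            = lim ((fun i => meas (X i) (A i `&` ball (point : X i) r)) @ omega).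
  have /uprod_ball ABr : uprod A `&` Obar omega X `<=` uprod B `&` Obar omega X.
    by rewrite AB.
  have /uprod_ball BAr : uprod B `&` Obar omega X `<=` uprod A `&` Obar omega X.
    by rewrite AB.
  apply: ultra_lim_eq; apply: filterS2 (ABr r) (BAr r) => i ABi BAi.
  by congr (meas _ _); apply/seteqP; split.
by under eq_fun do rewrite volE.
Qed.

Definition null_ubar (N : set (ubar omega X)) : Prop :=
  forall e : R, 0 < e ->
    exists E, [/\ algO E, N `<=` E & (mbar0 E < e%:E)%E].

Definition ubar_ball (r : R) : set (ubar omega X) :=
  uprod (fun i => ball (point : X i) r).

Definition approximates (A : set (ubar omega X))
    (Abar : R -> set (ubar omega X)) : Prop :=
  forall r : R, 0 < r ->
    algO (Abar r) /\ null_ubar ((A `&` ubar_ball r) `+` Abar r).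

Definition Bbar : set (set (ubar omega X)) :=
  [set A | A `<=` Obar omega X /\ exists Abar, approximates A Abar].

(* meaningful on [Bbar] when the sequence is [unif_bdd_finite] *)
Definition mbar (A : set (ubar omega X)) : \bar R :=
  get [set l | exists2 Abar, approximates A Abar &
                             mbar0 (Abar r) @[r --> +oo] --> l].

Definition ultralim_preimage (A : set (ultralim omega X)) : set (ubar omega X) :=
  val @` [set a : Otype omega X | A (\pi_(ultralim omega X) a)].

Definition mulim (A : set (ultralim omega X)) : \bar R :=
  mbar (ultralim_preimage A).

End ultralimit_measure.

Arguments Bbar {R} omega {Uomega} X.
Arguments mulim {R} omega {Uomega} X.

(* [iota] identifies Z with the support of the ultralimit, endowed with the   *)
(* restricted distance, the restricted measure and the base point of the      *)
(* ultralimit. The condition with [Bbar] says that the measure of the         *)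
(* ultralimit is indeed defined on the Borel subsets of its support.          *)
Definition is_spt_ultralimit (R : realType) (omega : set_system nat)
    {Uomega : UltraFilter omega} (X : nat -> ppmms R)
    (Z : ppmms R) (iota : Z -> ultralim omega X) : Prop :=
  [/\ range iota = spt (mulim omega X),
      forall x y, mdist (iota x) (iota y) = mdist x y,
      forall A : set (borel Z), measurable A ->
        Bbar omega X (ultralim_preimage (iota @` A)) /\
        meas Z A = mulim omega X (iota @` A) &
      iota point = ultralim_pt omega X].

(* Main.v *)
(* The points of [spt X_i] embed into the ultralimit as the classes of their  *)
(* orbits [(phi i j x)_j], and the limit space [Z] is the closure of the      *)
(* union of their images; it is complete because the ultralimit is (a         *)
(* diagonal argument). Pushing the measures of the [X_i] forward to [Z] gives *)
(* a nondecreasing sequence of measures, whose supremum is a measure, finite  *)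
(* on balls by uniform bounded finiteness. A target receives a 1-Lipschitz    *)
(* map from the dense union of the images, hence from [Z] by completeness:    *)
(* this is the universal property. Conversely a direct limit bounds the       *)
(* volumes of the balls of the [X_i] by those of its own balls.               *)
(*                                                                            *)
(* The measure of [Z] is the one of the ultralimit since, for any set [S] of  *)
(* the ultralimit with Borel traces [S_j] on the [X_j], the preimage of [S]   *)
(* in the ball of radius [r] agrees up to a null set with the internal set    *)
(* built on the [S_j] cut by the balls of radius [r]. Indeed, for [i] large   *)
(* the ball of [X_i] nearly has the maximal volume, and inner regularity      *)
(* provides compacts of [X_i], inside and outside of [S_i], that nearly fill  *)
(* it; a sequence of points taken in the images of such a compact in the      *)
(* [X_j] converges in the ultralimit to a point coming from that compact, so  *)
(* it is on the right side of [S]. The points avoiding these images form an   *)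
(* internal set of small volume.                                              *)
From HB Require Import structures.
Require Import Defs.
From mathcomp Require Import all_boot all_order all_algebra generic_quotient.
From mathcomp Require Import all_classical all_reals all_analysis.
From mathcomp Require Import ring lra.

Set Implicit Arguments.
Unset Strict Implicit.
Unset Printing Implicit Defensive.

Import Order.TTheory GRing.Theory Num.Theory.
Import numFieldNormedType.Exports.

Local Open Scope classical_set_scope.
Local Open Scope ring_scope.
Local Open Scope quotient_scope.

(** * Metric and Polish measure spaces *)

(** Transition maps are 1-Lipschitz on supports and push each measure below the next, so along the
    system distances between orbits decrease and volumes of balls around the base points increase.
    Two orbits at limit distance below [r] are thus already so at a finite stage ([emb_dist_lt]),
    and the limit measure is a supremum of pushforwards ([sup_pushforward]). This yields finiteness
    on balls ([limit_meas_ball_le], [sup_ball_meas_lty]) and the universal property ([target_lip],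
    [target_extension]).

    The comparison with the ultralimit rests on [mulimE], which computes [mulim] as the same
    supremum. Behind it is [trace_set_approximates]: by [borel_inner_regular] and [orbit_limit],
    almost all of a ball is governed by compacts of one fixed [X i]. As the limit has full support
    ([limit_meas_gt0]), it is exactly the support of [mulim]. Necessity of the bound is
    [direct_limit_bdd_finite], and uniqueness is [direct_limit_unique]. *)

Section metric_sets.
Context (R : realType) (T : metricType R).
Implicit Types (x y : T) (U A : set T) (e r : R).

Lemma metric_openP U :
  open U <-> forall x, U x -> exists2 e : R, 0 < e & ball x e `<=` U.
Proof.
rewrite openE; split=> [oU x /oU|h x /h].
  by move=> /nbhs_ballP[e e0 eU]; exists e.
by case=> e e0 eU; apply/nbhs_ballP; exists e.
Qed.

Lemma metric_ball_open x r : open (ball x r).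
Proof.
apply/metric_openP => y; rewrite ballEmdist /= => xy.
exists (r - mdist x y); first by rewrite subr_gt0.
move=> z; rewrite !ballEmdist /= => yz.
by rewrite (le_lt_trans (metric_triangle _ y _))// -ltrBrDl.
Qed.

Lemma metric_closedP A : closed A <->
  forall x, (forall e, 0 < e -> exists2 y, A y & mdist x y < e) -> A x.
Proof.
split=> [cA x h|h x clx].
  apply: cA => B /nbhs_ballP[e e0 eB]; have [y Ay xy] := h _ e0.
  by exists y; split => //; apply: eB; rewrite ballEmdist.
apply: h => e e0; have [y [Ay]] := clx _ (nbhsx_ballx x e e0).
by rewrite ballEmdist => xy; exists y.
Qed.

Lemma metric_closureP A x : closure A x <->
  forall e, 0 < e -> exists2 y, A y & mdist x y < e.
Proof.
split=> [clx e e0|h B /nbhs_ballP[e e0 eB]].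
  have [y [Ay]] := clx _ (nbhsx_ballx x e e0).
  by rewrite ballEmdist => xy; exists y.
by have [y Ay xy] := h _ e0; exists y; split => //; apply: eB; rewrite ballEmdist.
Qed.

Lemma closed_mdist_le x r : closed [set y | mdist x y <= r].
Proof.
apply/metric_closedP => y h; rewrite /= leNgt; apply/negP => xy.
have [|z /= xz yz] := h (mdist x y - r); first by rewrite subr_gt0.
have := metric_triangle x z y; rewrite (metric_sym z) leNgt => /negP; apply.
by rewrite (le_lt_trans (lerD xz (lexx _)))// -ltrBrDl.
Qed.

Lemma lip_within_continuous (T' : metricType R) (f : T -> T') A :
  (forall x y, A x -> A y -> mdist (f x) (f y) <= mdist x y) ->
  {within A, continuous f}.
Proof.
move=> lf; apply/subspace_continuousP => x Ax B /nbhs_ballP[e e0 eB].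
rewrite /= withinE nbhs_simpl /=.
exists [set y | A y -> B (f y)]; last first.
  by apply/seteqP; split=> y [] By Ay; split => //; exact: By.
apply/nbhs_ballP; exists e => // y; rewrite ballEmdist => xy Ay; apply: eB.
by rewrite ballEmdist /= (le_lt_trans (lf _ _ Ax Ay)).
Qed.

End metric_sets.

(** * Ultrafilters, compactness and Borel sets *)

Lemma ultra_bigcup_ord (I : Type) (F : set_system I) (B : nat -> set I) n :
  UltraFilter F -> F (\bigcup_(i < n) B i) -> exists i, F (B i).
Proof.
move=> UF FB; apply: contrapT => nF.
have FC i : F (~` B i).
  by have [FBi|//] := in_ultra_setVsetC (B i) UF; case: nF; exists i.
have FI : F (\bigcap_(i < n) ~` B i).
  elim: n {FB} => [|n IH]; first by apply: filterS filterT => x _ i.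
  apply: filterS (filterI IH (FC n)) => x [h1 h2] i /=.
  by rewrite ltnS leq_eqVlt => /orP[/eqP->//|/h1].
have [x [[i /= ni Bi] /(_ i ni)]] := filter_ex (filterI FB FI).
exact.
Qed.

Lemma invS_lt (R : realType) (e : R) : 0 < e -> exists k, k.+1%:R^-1 < e.
Proof.
move=> e0; have [k _ h] := near_infty_natSinv_lt (PosNum e0).
by exists k; exact: h (leqnn k).
Qed.


(** An ultrafilter on [K] selects one ball from each finite cover, hence is Cauchy; completeness
    gives its limit and closedness keeps it in [K]. *)
Lemma compact_totally_bounded (R : realType) (T : completeMetricType R)
    (K : set T) : closed K ->
  (forall e : R, 0 < e -> exists n (c : nat -> T),
     K `<=` \bigcup_(i < n) ball (c i) e) ->
  compact K.
Proof.
move=> cK tK; rewrite compact_ultra => F UF FK.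
have /cauchy_cvg cF : cauchy F.
  apply: cauchy_exP => e e0; have [n [c Kc]] := tK _ e0.
  have [|i Fi] := @ultra_bigcup_ord _ F (fun i => ball (c i) e) n UF.
    exact: filterS FK.
  by exists (c i).
exists (lim F); split => //.
by apply: cK => B /cF FB; exact: filter_ex (filterI FK FB).
Qed.

Section borel_metric.
Context (R : realType) (T : completeMetricType R).

Lemma open_borel (U : set (borel T)) : open (U : set T) -> measurable U.
Proof. by move=> oU; exact: sub_sigma_algebra. Qed.

Lemma closed_borel (C : set (borel T)) : closed (C : set T) -> measurable C.
Proof.
move=> cC; rewrite -(setCK C); apply: measurableC; apply: open_borel.
exact: closed_openC.
Qed.

Lemma ball_borel (x : T) (r : R) : measurable (ball x r : set (borel T)).
Proof. by apply: open_borel; exact: metric_ball_open. Qed.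

Lemma compact_borel (C : set (borel T)) : compact (C : set T) -> measurable C.
Proof.
move=> cC; apply: closed_borel; apply: compact_closed => //.
exact: metric_hausdorff.
Qed.

End borel_metric.

(** * Polish measure spaces: support, tightness, inner regularity *)

Section polish.
Context (R : realType) (X : ppmms R).
Implicit Types (x y : X) (U C : set X) (A B : set (borel X)) (e r : R).

Notation m := (meas X).

Lemma dense_seq (S : set X) x0 : S x0 -> exists t : nat -> X,
  (forall n, S (t n)) /\
  forall x e, S x -> 0 < e -> exists n, mdist x (t n) < e.
Proof.
move=> Sx0; have [D cD dD] := ppmms_separable X.
have [s hs] : exists s : nat -> X, forall x e, 0 < e -> exists n, mdist x (s n) < e.
  have [d Dd] : D !=set0.
    have [||z [_ Dz]] := dD setT; [by exists x0|exact: openT|by exists z].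
  have /pfcard_geP[D0|[g]] := cD; first by rewrite D0 in Dd.
  exists g => x e e0.
  have [|z [xz Dz]] := dD (ball x e) _ (metric_ball_open x e).
    by exists x; exact: ballxx.
  have [n _ gn] := @surj _ _ _ _ g z Dz.
  by exists n; rewrite gn; rewrite ballEmdist in xz.
pose P (k : nat * nat) y := S y /\ mdist (s k.1) y < k.2.+1%:R^-1.
(* A point of [S] within [1/(k.2+1)] of [s k.1] if there is one, and the default [x0] otherwise. *)
pose u k := xget x0 (P k).
exists (fun n => if unpickle n is Some k then u k else x0).
split=> [n|x e Sx e0].
  by case: unpickle => // k; rewrite /u; case: xgetP => // y _ [].
have [k ke] : exists k, k.+1%:R^-1 < e / 2 by apply: invS_lt; rewrite divr_gt0.
have [n xn] := hs x k.+1%:R^-1 ltac:(by rewrite invr_gt0).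
exists (pickle (n, k)); rewrite pickleK.
have [_ un] : P (n, k) (u (n, k)).
  by rewrite /u; case: xgetP => [y _//|/(_ x) []]; split=> //=; rewrite metric_sym.
rewrite (le_lt_trans (metric_triangle _ (s n) _))// (splitr e) ltrD//.
  exact: lt_trans xn _.
exact: lt_trans un _.
Qed.

Lemma open_bigcup_ball U : open U -> exists t : nat -> X,
  U = \bigcup_(k in [set k : nat * nat | ball (t k.1) k.2.+1%:R^-1 `<=` U])
        ball (t k.1) k.2.+1%:R^-1.
Proof.
move=> /metric_openP oU; have [t [_ ht]] := @dense_seq setT point I.
exists t; apply/seteqP; split=> [x Ux|x [k /= kU /kU//]].
have [e e0 xe] := oU _ Ux.
have [k ke] : exists k, k.+1%:R^-1 < e / 2 by apply: invS_lt; rewrite divr_gt0.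
have [n xn] := ht x k.+1%:R^-1 I ltac:(by rewrite invr_gt0).
exists (n, k) => /=; last by rewrite ballEmdist /= metric_sym.
move=> y; rewrite ballEmdist /= => ny; apply: xe; rewrite ballEmdist /=.
rewrite (le_lt_trans (metric_triangle _ (t n) _))// (splitr e) ltrD//.
  exact: lt_trans xn _.
exact: lt_trans ny _.
Qed.

(** By separability every open set is a countable union of balls, so internal sets may be built from
    Borel sets. *)
Lemma ball_algebraE A : ball_algebra (A : set X) <-> measurable A.
Proof.
split; move: A; apply: smallest_sub.
- exact: sigma_algebra_measurable.
- by move=> _ [x [r [_ ->]]]; exact: ball_borel.
- exact: smallest_sigma_algebra.
- move=> U oU; have [t ->] := open_bigcup_ball oU.
  rewrite bigcup_mkcond.
  pose G := [set B : set X | exists (x : X) (r : R), 0 < r /\ B = ball x r].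
  suff : measurable (\bigcup_k (if k \in
      [set k : nat * nat | ball (t k.1) (k.2.+1%:R^-1 : R) `<=` U]
      then ball (t k.1) k.2.+1%:R^-1 else set0) : set (g_sigma_algebraType G)).
    by [].
  apply: countable_bigcupT_measurable => // k; case: ifP => // _.
  by apply: sub_sigma_algebra; exists (t k.1), k.2.+1%:R^-1; split.
Qed.

Lemma spt_closed : closed (sptm X).
Proof.
apply/metric_closedP => x h r r0.
have [|y yS xy] := h (r / 2); first by rewrite divr_gt0.
apply: (lt_le_trans (yS (r / 2) _)); first by rewrite divr_gt0.
apply: le_measure; rewrite ?inE; [exact: ball_borel|exact: ball_borel|].
move=> z; rewrite !ballEmdist /= => yz.
by rewrite (le_lt_trans (metric_triangle _ y _))// (splitr r) ltrD.
Qed.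

Lemma spt_borel : measurable (sptm X : set (borel X)).
Proof. exact: closed_borel spt_closed. Qed.

Lemma le_meas A B : measurable A -> measurable B -> A `<=` B -> (m A <= m B)%E.
Proof. by move=> mA mB; apply: le_measure; rewrite inE. Qed.

Lemma meas_bigcup0 (F : nat * nat -> set (borel X)) :
  (forall k, measurable (F k)) -> (forall k, m (F k) = 0%E) ->
  m (\bigcup_k F k) = 0%E.
Proof.
move=> mF F0; pose G n := if unpickle n is Some k then F k else set0.
have mG n : measurable (G n) by rewrite /G; case: unpickle.
have FG : \bigcup_k F k `<=` \bigcup_n G n.
  by move=> x [k _ Fx]; exists (pickle k) => //; rewrite /G pickleK.
have mFU : measurable (\bigcup_k F k) by exact: countable_bigcupT_measurable.
apply/eqP; rewrite eq_le measure_ge0 andbT.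
rewrite (le_trans (measure_sigma_subadditive m mG mFU FG))// eseries0// => n _ _.
by rewrite /G; case: unpickle => // k; exact: F0.
Qed.

(** Lindelöf argument: a null ball around a point outside of the support contains a smaller ball
    around that point, taken from the countable family with centres in a dense sequence and radii
    [1/(k+1)]. *)
Lemma measCspt : m (~` sptm X) = 0%E.
Proof.
have [t0 [_ ht0]] := @dense_seq setT point I.
pose P k := m (ball (t0 k.1) k.2.+1%:R^-1) == 0%E.
pose F (k : nat * nat) := if P k then ball (t0 k.1) k.2.+1%:R^-1 else set0.
have mF k : measurable (F k : set (borel X)).
  by rewrite /F; case: ifP => // _; exact: ball_borel.
have F0 k : m (F k) = 0%E by rewrite /F; case: ifP => [/eqP//|]; rewrite measure0.
apply: (@subset_measure0 _ _ _ m _ (\bigcup_k F k)).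
- by apply: measurableC; exact: spt_borel.
- exact: countable_bigcupT_measurable.
- move=> x nx.
  have [e [e0 xe]] : exists e, 0 < e /\ m (ball x e) = 0%E.
    apply: contrapT => h; apply: nx => e e0; rewrite lt0e measure_ge0 andbT.
    by apply/eqP => h0; apply: h; exists e.
  have [k ke] : exists k, k.+1%:R^-1 < e / 2 by apply: invS_lt; rewrite divr_gt0.
  have [n xn] := ht0 x k.+1%:R^-1 I ltac:(by rewrite invr_gt0).
  exists (n, k) => //; rewrite /F ifT; first by rewrite ballEmdist /= metric_sym.
  apply/eqP; apply: (@subset_measure0 _ _ _ m _ (ball x e)) => //.
  + exact: ball_borel.
  + exact: ball_borel.
  + move=> y; rewrite !ballEmdist /= => ny.
    rewrite (le_lt_trans (metric_triangle _ (t0 n) _))// (splitr e) ltrD//.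
      exact: lt_trans xn _.
    exact: lt_trans ny _.
- exact: meas_bigcup0.
Qed.

Lemma measIspt A : measurable A -> m (A `&` sptm X) = m A.
Proof.
move=> mA; rewrite [RHS](measureDI m mA spt_borel).
rewrite -[LHS]add0e; congr (_ + _)%E; apply/esym.
apply: (@subset_measure0 _ _ _ m _ (~` sptm X)) measCspt.
- by apply: measurableD => //; exact: spt_borel.
- by apply: measurableC; exact: spt_borel.
- by move=> x [].
Qed.

(** The complement of the support is null, so inclusions may be tested on the support, where
    morphisms are controlled. *)
Lemma le_meas_spt A B : measurable A -> measurable B ->
  A `&` sptm X `<=` B -> (m A <= m B)%E.
Proof.
move=> mA mB AB; rewrite -measIspt//; apply: le_meas => //.
by apply: measurableI => //; exact: spt_borel.
Qed.

Lemma meas_setD_small B (F : nat -> set (borel X)) e :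
  measurable B -> (m B < +oo)%E -> (forall n, measurable (F n)) ->
  nondecreasing_seq F -> B `<=` \bigcup_n F n -> 0 < e ->
  exists n, (m (B `\` F n) < e%:E)%E.
Proof.
move=> mB fB mF ndF BF e0; pose G n := B `\` F n.
have G0 : \bigcap_n G n = set0.
  by apply/seteqP; split=> x // h; have [/BF[n _ Fx] _] := h 0%N I;
    have [] := h n I.
have mG n : measurable (G n) by exact: measurableD.
have : m \o G @ \oo --> m (\bigcap_n G n).
  apply: nonincreasing_cvg_mu => //.
  - by apply: le_lt_trans fB; apply: le_meas => // x [].
  - by rewrite G0.
  - by move=> i j ij; apply/subsetPset => x [Bx nF]; split=> // Fx; apply: nF;
      exact: (subsetPset _ _ (ndF _ _ ij)).
rewrite G0 measure0 => cG.
have /fine_cvgP[fG] := cG; move/cvgr0Pnorm_lt => /(_ e e0) hG.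
have [n [h1 h2]] := filter_ex (filterI fG hG); exists n.
by move: (h1) => /fineK /= <-; rewrite lte_fin (le_lt_trans (ler_norm _)).
Qed.

Lemma meas_bigcup_geometric (G : nat -> set (borel X)) e :
  0 < e -> (forall n, measurable (G n)) ->
  (forall n, (m (G n) <= (e / (2 ^ n.+1)%:R)%:E)%E) ->
  (m (\bigcup_n G n) <= e%:E)%E.
Proof.
move=> e0 mG hG.
have mUG := bigcupT_measurable _ mG.
apply: (le_trans (measure_sigma_subadditive m mG mUG (@subset_refl _ _))).
apply: le_trans (epsilon_trick0 xpredT (ltW e0)).
by apply: lee_nneseries => // n _; exact: measure_ge0.
Qed.

(** Ulam's tightness theorem: at scale [1/(k+1)] finitely many closed balls cover [B] up to
    [e / 2^(k+1)]; the intersection over all scales is closed and totally bounded. *)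
Lemma ulam B e : measurable B -> (m B < +oo)%E -> 0 < e ->
  exists K : set (borel X), [/\ compact (K : set X), measurable K &
    (m (B `\` K) <= e%:E)%E].
Proof.
move=> mB fB e0; have [t [_ ht]] := @dense_seq setT point I.
pose F k n : set (borel X) := \bigcup_(i < n) [set y | mdist (t i) y <= k.+1%:R^-1].
have cF k n : closed (F k n : set X).
  by apply: closed_bigcup => // i _; exact: closed_mdist_le.
have mF k n : measurable (F k n) by exact: closed_borel.
have /choice[N hN] k : exists n, (m (B `\` F k n) < (e / (2 ^ k.+1)%:R)%:E)%E.
  apply: meas_setD_small => //.
  - move=> a b ab; apply/subsetPset => x [i /= ia xi].
    by exists i => //=; exact: leq_trans ab.
  - move=> x _; have [n xn] := ht x k.+1%:R^-1 I ltac:(by rewrite invr_gt0).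
    by exists n.+1 => //; exists n => //=; rewrite metric_sym ltW.
  - by rewrite divr_gt0// ltr0n expn_gt0.
pose K : set (borel X) := \bigcap_k F k (N k).
have cK : closed (K : set X) by apply: closed_bigI => k _; exact: cF.
exists K; split.
- apply: compact_totally_bounded => // r r0.
  have [k kr] := invS_lt r0.
  exists (N k), t => x /(_ k I)[i /= ik xi]; exists i => //.
  by rewrite ballEmdist /= (le_lt_trans xi).
- exact: closed_borel.
- have -> : B `\` K = \bigcup_k (B `\` F k (N k)).
    by rewrite /K setDE setC_bigcap setI_bigcupr.
  apply: meas_bigcup_geometric => // [k|k]; first exact: measurableD.
  exact/ltW/hN.
Qed.

(* The sets approximated from inside by compacts, together with their         *)
(* complements, form a sigma-algebra containing the open sets.                *)
Lemma borel_inner_regular A B e : measurable A ->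
  measurable B -> (m B < +oo)%E -> 0 < e ->
  exists C C' : set (borel X),
    [/\ compact (C : set X) /\ compact (C' : set X),
        C `<=` A, C' `<=` ~` A & (m (B `\` (C `|` C')) <= e%:E)%E].
Proof.
move=> mA mB fB; move: A mA e.
pose G : set (set X) := [set A | forall e, 0 < e -> exists C C' : set (borel X),
    [/\ compact (C : set X) /\ compact (C' : set X),
        C `<=` A, C' `<=` ~` A & (m (B `\` (C `|` C')) <= e%:E)%E]].
suff : <<s (@open X) >> `<=` G by [].
have GC A : G A -> G (~` A).
  move=> GA e /GA[C [C' [[cC cC'] CA CA' mC]]]; exists C', C.
  by rewrite setUC setCK.
apply: smallest_sub; last first.
  move=> U oU e e0.
  have e20 : 0 < e / 2 by rewrite divr_gt0.
  have [K [cK mK BK]] := ulam mB fB e20.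
  (* The points at distance at least [1/(n+1)] from the complement of [U]: closed sets increasing to
     [U]. *)
  pose F n : set (borel X) := ~` \bigcup_(y in ~` U) ball y (n.+1%:R^-1 : R).
  have cF n : closed (F n : set X).
    by apply: open_closedC; apply: bigcup_open => y _; exact: metric_ball_open.
  have mF n : measurable (F n) by exact: closed_borel.
  have FU n : F n `<=` U.
    move=> x Fx; apply: contrapT => nU; apply: Fx; exists x => //.
    by apply: ballxx; rewrite invr_gt0.
  have mU : measurable (U : set (borel X)) by exact: open_borel.
  have [||||n hn] := @meas_setD_small (B `&` U) F (e / 2) _ _ mF _ _ e20.
  - exact: measurableI.
  - by apply: le_lt_trans fB; apply: le_meas => //; exact: measurableI.
  - move=> a b ab; apply/subsetPset => x Fx [y Uy xy]; apply: Fx; exists y => //.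
    move: xy; rewrite !ballEmdist /= => /lt_le_trans; apply.
    by rewrite lef_pV2 ?posrE// ler_nat.
  - move=> x [_ Ux]; move/metric_openP: oU => /(_ _ Ux)[r r0 xr].
    have [k kr] := invS_lt r0.
    exists k => // -[y Uy]; rewrite ballEmdist /= => yx; apply: Uy; apply: xr.
    by rewrite ballEmdist /= metric_sym (lt_trans yx).
  exists (F n `&` K), (K `\` U).
  have cFK : compact (F n `&` K : set X) by rewrite setIC; exact: compact_closedI.
  have cKU : compact (K `\` U : set X).
    by apply: compact_closedI => //; exact: open_closedC.
  split => //; first by move=> x [/FU].
  rewrite (splitr e) EFinD; apply: le_trans (leeD (ltW hn) BK).
  apply: le_trans (measureU2 _ _ _).
  - apply: le_meas.
    + apply: measurableD => //; apply: measurableU; exact: compact_borel.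
    + apply: measurableU; last exact: measurableD.
      by apply: measurableD => //; exact: measurableI.
    + move=> x [Bx nx]; have [Kx|nK] := pselect (K x); last by right.
      left; split; first split => //.
        by apply: contrapT => nU; apply: nx; right.
      by move=> Fx; apply: nx; left.
  - by apply: measurableD => //; exact: measurableI.
  - exact: measurableD.
split.
- by rewrite -setCT; apply: GC => e e0; have [K [cK mK BK]] := ulam mB fB e0;
    exists K, set0; rewrite setU0; split => //; split => //; exact: compact0.
- by move=> A GA; rewrite setTD; exact: GC.
- move=> A GA e e0.
  have e20 : 0 < e / 2 by rewrite divr_gt0.
  have /choice[C hC] n : exists C : set (borel X) * set (borel X),
    [/\ compact (C.1 : set X) /\ compact (C.2 : set X),
        C.1 `<=` A n, C.2 `<=` ~` A n &
        (m (B `\` (C.1 `|` C.2)) <= (e / 2 / (2 ^ n.+1)%:R)%:E)%E].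
    have [|C [C' h]] := GA n (e / 2 / (2 ^ n.+1)%:R).
      by rewrite divr_gt0// ltr0n expn_gt0.
    by exists (C, C').
  have mC n : measurable (C n).1 /\ measurable (C n).2.
    by have [[h1 h2] _ _ _] := hC n; split; exact: compact_borel.
  pose D n := \bigcup_(i < n) (C i).1.
  have mD n : measurable (D n).
    by apply: bigcup_measurable => i _; have [] := mC i.
  have mU : measurable (\bigcup_i (C i).1).
    by apply: bigcupT_measurable => i; have [] := mC i.
  have mI : measurable (\bigcap_i (C i).2).
    by apply: bigcapT_measurable => i; have [] := mC i.
  have [||||n hn] :=
    @meas_setD_small (B `&` \bigcup_i (C i).1) D (e / 2) _ _ mD _ _ e20.
  - exact: measurableI.
  - by apply: le_lt_trans fB; apply: le_meas => //; exact: measurableI.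
  - move=> a b ab; apply/subsetPset => x [i /= ia xi].
    by exists i => //=; exact: leq_trans ab.
  - by move=> x [_ [i _ xi]]; exists i.+1 => //; exists i => /=.
  have cD : compact (D n : set X).
    rewrite /D bigcup_mkord; apply: bigsetU_compact => i _.
    by have [[]] := hC i.
  (* Inside, finitely many compacts are kept so that their union is compact, at the cost of [e / 2];
     outside, all of them are intersected. The other [e / 2] is shared geometrically between the
     indices. *)
  exists (D n), (\bigcap_i (C i).2); split.
  - split => //.
    have [[_ c0] _ _ _] := hC 0%N.
    apply: subclosed_compact c0 _; last by move=> x /(_ 0%N I).
    apply: closed_bigI => i _; apply: compact_closed; first exact: metric_hausdorff.
    by have [[]] := hC i.
  - by move=> x [i _ xi]; exists i => //; have [_ h _ _] := hC i; exact: h.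
  - by move=> x h [i _ Ai]; have [_ _ h' _] := hC i; exact: h' (h i I) Ai.
  have hG : (m (\bigcup_i (B `\` ((C i).1 `|` (C i).2))) <= (e / 2)%:E)%E.
    apply: meas_bigcup_geometric => // i; last by have [] := hC i.
    by have [] := mC i => ? ?; apply: measurableD => //; exact: measurableU.
  rewrite (splitr e) EFinD; apply: le_trans (leeD (ltW hn) hG).
  have mG : measurable (\bigcup_i (B `\` ((C i).1 `|` (C i).2))).
    apply: bigcupT_measurable => i.
    by have [] := mC i => ? ?; apply: measurableD => //; exact: measurableU.
  have mBD : measurable (B `&` \bigcup_i (C i).1 `\` D n).
    by apply: measurableD => //; exact: measurableI.
  apply: le_trans (measureU2 _ mBD mG).
  apply: le_meas.
  + by apply: measurableD => //; exact: measurableU.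
  + exact: measurableU.
  move=> x [Bx nx].
  have [Ux|nU] := pselect ((\bigcup_i (C i).1) x).
    by left; split => // Dx; apply: nx; left.
  right.
  have [i ni] : exists i, ~ (C i).2 x.
    by apply/existsNP => h; apply: nx; right => i _.
  exists i => //; split=> // -[xi|//]; apply: nU; exists i => //.
Qed.

End polish.

(** * Volumes of internal sets *)

Section ultrafilter_on_nat.
Context (R : realType) (omega : set_system nat) {Uomega : UltraFilter omega}.

Lemma nonprincipal_tail n : nonprincipal omega -> omega [set i | (n <= i)%N].
Proof.
move=> np; have nC k : omega (~` [set k]).
  by have [/np//|] := in_ultra_setVsetC [set k] Uomega.
elim: n => [|n IH]; first by apply: filterS filterT.
apply: filterS (filterI IH (nC n)) => i [/= ni in_].
by rewrite ltn_neqAle ni andbT; apply/eqP => e; apply: in_.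
Qed.

(** A non-principal ultrafilter contains all tails, so ordinary convergence implies convergence
    along it. *)
Lemma ultra_cvg_nondecreasing (u : nat -> \bar R) : nonprincipal omega ->
  nondecreasing_seq u -> lim (u @ omega) = ereal_sup (range u).
Proof.
move=> np /ereal_nondecreasing_cvgn cu; apply/cvg_lim => //.
apply: cvg_trans cu => A [n _ nA].
exact: filterS nA (nonprincipal_tail n np).
Qed.

End ultrafilter_on_nat.

Section volumes.
Context (R : realType) (omega : set_system nat) {Uomega : UltraFilter omega}.
Context (X : nat -> ppmms R).
Implicit Types (A B : forall i, set (X i)).
Implicit Types (E N : set (ubar omega X)).

Lemma ball_familyP A : ball_family omega A <->
  \forall i \near omega, measurable (A i : set (borel (X i))).
Proof. by split; apply: filterS => i /ball_algebraE. Qed.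

Lemma uprodU A B :
  uprod (omega := omega) (fun i => A i `|` B i) = uprod A `|` uprod B.
Proof.
apply/seteqP; split=> a; last first.
  by move=> [|]; apply: filterS => i ?; [left|right].
move=> AB; have [|] := in_ultra_setVsetC [set i | A i (repr a i)] Uomega.
  by move=> ?; left.
by move=> nA; right; apply: filterS2 AB nA => i [].
Qed.

Lemma ball_familyU A B : ball_family omega A -> ball_family omega B ->
  ball_family omega (fun i => A i `|` B i).
Proof.
move=> /ball_familyP mA /ball_familyP mB; apply/ball_familyP.
by apply: filterS2 mA mB => i; exact: measurableU.
Qed.

Let vol A (r : R) :=
  lim ((fun i => meas (X i) (A i `&` ball (point : X i) r)) @ omega).

Let vol_le A B r : ball_family omega A -> ball_family omega B ->
  (\forall i \near omega, A i `<=` B i) -> (vol A r <= vol B r)%E.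
Proof.
move=> /ball_familyP mA /ball_familyP mB AB; apply: ultra_lim_le.
apply: filterS3 mA mB AB => i mA mB AB; apply: le_meas.
- by apply: measurableI => //; exact: ball_borel.
- by apply: measurableI => //; exact: ball_borel.
- by move=> x [/AB].
Qed.

Let vol_nd A : ball_family omega A -> nondecreasing_fun (vol A).
Proof.
move=> /ball_familyP mA r s rs; apply: ultra_lim_le.
apply: filterS mA => i mA; apply: le_meas.
- by apply: measurableI => //; exact: ball_borel.
- by apply: measurableI => //; exact: ball_borel.
- by move=> x [Ax xr]; split => //; exact: le_ball xr.
Qed.

Lemma fam_vol_ge0 A : ball_family omega A -> (0 <= fam_vol omega A)%E.
Proof.
move=> bA; apply: lime_ge; first exact/nondecreasing_is_cvge/vol_nd.
by apply: nearW => r; apply: ultra_lim_ge0.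
Qed.

Lemma fam_vol_le A B : ball_family omega A -> ball_family omega B ->
  (\forall i \near omega, A i `<=` B i) -> (fam_vol omega A <= fam_vol omega B)%E.
Proof.
move=> bA bB AB; apply: lee_lim.
- exact/nondecreasing_is_cvge/vol_nd.
- exact/nondecreasing_is_cvge/vol_nd.
- by apply: nearW => r; exact: vol_le.
Qed.

Lemma fam_volU A B : ball_family omega A -> ball_family omega B ->
  (fam_vol omega (fun i => A i `|` B i)
     <= fam_vol omega A + fam_vol omega B)%E.
Proof.
move=> bA bB.
have cA : cvg (vol A @ +oo) by exact/nondecreasing_is_cvge/vol_nd.
have cB : cvg (vol B @ +oo) by exact/nondecreasing_is_cvge/vol_nd.
rewrite /fam_vol -limeD//; last first.
  by apply: ge0_adde_def; rewrite inE; exact: fam_vol_ge0.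
apply: lee_lim.
- exact/nondecreasing_is_cvge/vol_nd/ball_familyU.
- apply: is_cvgeD => //.
  by apply: ge0_adde_def; rewrite inE; exact: fam_vol_ge0.
apply: nearW => r; rewrite -ultra_limD//.
move: bA bB => /ball_familyP mA /ball_familyP mB; apply: ultra_lim_le.
apply: filterS2 mA mB => i mA mB; rewrite setIUl.
by apply: measureU2; apply: measurableI => //; exact: ball_borel.
Qed.

Lemma fam_vol_bounded A r :
  (\forall i \near omega, A i `<=` ball (point : X i) r) ->
  fam_vol omega A = lim ((fun i => meas (X i) (A i)) @ omega).
Proof.
move=> Ar; apply/cvg_lim => //; apply: cvg_near_cst.
exists r; split; first exact: num_real.
move=> s rs; apply: ultra_lim_eq; apply: filterS Ar => i Ar.
congr (meas _ _); apply/setIidPl => x /Ar; apply: le_ball.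
exact: ltW.
Qed.

Lemma algO_uprod A : ball_family omega A -> algO (uprod A `&` Obar omega X).
Proof. by move=> bA; exists A. Qed.

Lemma algOU E F : algO E -> algO F -> algO (E `|` F).
Proof.
move=> [A bA ->] [B bB ->]; rewrite -setIUl -uprodU.
exact/algO_uprod/ball_familyU.
Qed.

Lemma mbar0_le E F : algO E -> algO F -> E `<=` F -> (mbar0 E <= mbar0 F)%E.
Proof.
move=> [A bA ->] [B bB ->] AB.
(* The inclusion is known between the sets of classes in [Obar]; enlarging [B] by [A] leaves that
   set unchanged and makes the inclusion hold in each factor. *)
have -> : uprod B `&` Obar omega X = uprod (fun i => B i `|` A i) `&` Obar omega X.
  by rewrite uprodU setIUl setUidl.
rewrite !mbar0E//; last exact: ball_familyU.
apply: fam_vol_le => //; first exact: ball_familyU.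
by apply: nearW => i x Ax; right.
Qed.

Lemma mbar0U E F : algO E -> algO F -> (mbar0 (E `|` F) <= mbar0 E + mbar0 F)%E.
Proof.
move=> [A bA ->] [B bB ->]; rewrite -setIUl -uprodU !mbar0E//.
  exact: fam_volU.
exact: ball_familyU.
Qed.

Lemma null_ubarU N N' : null_ubar N -> null_ubar N' -> null_ubar (N `|` N').
Proof.
move=> nN nN' e e0; have e20 : 0 < e / 2 by rewrite divr_gt0.
have [E [aE NE mE]] := nN _ e20; have [F [aF NF mF]] := nN' _ e20.
exists (E `|` F); split; [exact: algOU|exact: setUSS|].
apply: le_lt_trans (mbar0U aE aF) _.
by rewrite [e in (_ < e%:E)%E]splitr EFinD lteD.
Qed.

Lemma mbar0_le_null E F N : algO E -> algO F -> null_ubar N ->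
  E `<=` F `|` N -> (mbar0 E <= mbar0 F)%E.
Proof.
move=> aE aF nN EFN; apply/lee_addgt0Pr => e /nN[G [aG NG mG]].
apply: (@le_trans _ _ (mbar0 (F `|` G))).
  apply: mbar0_le => //; first exact: algOU.
  by move=> x /EFN[Fx|/NG Gx]; [left|right].
by apply: le_trans (mbar0U aF aG) _; rewrite leeD2l// ltW.
Qed.

(** Two approximations of one set differ by a null set, and volumes are monotone up to null sets. *)
Lemma approximates_mbar0 (S : set (ubar omega X)) Sr Tr r :
  approximates S Sr -> approximates S Tr -> 0 < r ->
  mbar0 (Sr r) = mbar0 (Tr r).
Proof.
move=> hS hT r0; have [aS nS] := hS r r0; have [aT nT] := hT r r0.
have nST := null_ubarU nS nT.
apply/le_anti/andP; split; apply: (mbar0_le_null _ _ nST) => // x h.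
- have [|nT'] := pselect (Tr r x); first by left.
  right; have [Sx|nS'] := pselect ((S `&` ubar_ball r) x).
    by right; left.
  by left; right.
- have [|nS'] := pselect (Sr r x); first by left.
  right; have [Sx|nSx] := pselect ((S `&` ubar_ball r) x).
    by left; left.
  by right; right.
Qed.

Lemma mbarE (S : set (ubar omega X)) Sr l : approximates S Sr ->
  mbar0 (Sr r) @[r --> +oo] --> l -> mbar S = l.
Proof.
move=> hS cS; apply: get_unique; first by exists Sr.
move=> l' [Tr hT cT]; apply: cvg_unique cT _ => //.
apply: cvg_trans cS; apply: near_eq_cvg; exists 0; split => //.
by move=> r r0; exact: approximates_mbar0 hS hT r0.
Qed.

End volumes.

(** * The ultralimit is complete *)

Definition sequentially_complete (T : uniformType) :=
  forall F : set_system T, ProperFilter F -> cauchy F -> exists z : T, F --> z.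

Section ultralimit_classes.
Context (R : realType) (omega : set_system nat) {Uomega : UltraFilter omega}.
Context (X : nat -> ppmms R).
Implicit Types (x y : forall i, X i).
Notation UL := (ultralim omega X).

Definition ubounded x := \pi_(ubar omega X) x \in Obar omega X.

(** The class written [[[x_i]]]; unbounded families get the base point as a default. *)
Definition uclass x : UL :=
  if pselect (ubounded x) is left h then \pi_UL (exist _ (\pi_(ubar omega X) x) h)
  else ultralim_pt omega X.

Lemma uboundedP x (r : R) :
  (\forall i \near omega, mdist (x i) point <= r) -> ubounded x.
Proof.
move=> xr; apply/mem_set; rewrite /Obar /= dbarE.
apply: (@le_lt_trans _ _ r%:E); last exact: ltry.
by apply: lime_le; [exact: ultra_cvg_ereal|apply: filterS xr => i; rewrite lee_fin].
Qed.

Lemma uclass_dist x y : ubounded x -> ubounded y ->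
  (mdist (uclass x) (uclass y))%:E = famdist omega x y.
Proof.
move=> bx by_; rewrite /uclass; case: pselect => // hx; case: pselect => // hy.
by rewrite (dist_ultralimE (exist (fun a => a \in Obar omega X) _ hx)
  (exist (fun a => a \in Obar omega X) _ hy)) /= dbarE.
Qed.

Lemma uclass_repr (a : Otype omega X) :
  ubounded (repr (val a)) /\ \pi_UL a = uclass (repr (val a)).
Proof.
have h : ubounded (repr (val a)) by rewrite /ubounded reprK; case: a.
split=> //; rewrite /uclass; case: pselect => // h'; congr (\pi_UL _).
by apply: val_inj; rewrite /= reprK.
Qed.

Lemma uclass_surj (z : UL) : exists2 x, ubounded x & z = uclass x.
Proof.
have [h e] := uclass_repr (repr z); exists (repr (val (repr z))) => //.
by rewrite -e reprK.
Qed.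

Lemma uclass_le x y (r : R) : ubounded x -> ubounded y ->
  (\forall i \near omega, mdist (x i) (y i) <= r) ->
  mdist (uclass x) (uclass y) <= r.
Proof.
move=> bx by_ xy; rewrite -lee_fin uclass_dist//.
by apply: lime_le; [exact: ultra_cvg_ereal|apply: filterS xy => i; rewrite lee_fin].
Qed.

(** Otherwise the ultrafilter contains the set where the reverse inequality holds, and that
    inequality passes to the limit. *)
Lemma uclass_lt x y (r : R) : ubounded x -> ubounded y ->
  mdist (uclass x) (uclass y) < r -> \forall i \near omega, mdist (x i) (y i) < r.
Proof.
move=> bx by_; rewrite -lte_fin uclass_dist// => xy.
have [//|h] := in_ultra_setVsetC [set i | mdist (x i) (y i) < r] Uomega.
suff : (r%:E <= famdist omega x y)%E by rewrite leNgt xy.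
apply: lime_ge; first exact: ultra_cvg_ereal.
by apply: filterS h => i /= /negP; rewrite -leNgt lee_fin.
Qed.

Lemma ubounded_point : ubounded (fun i => point).
Proof. by apply: (@uboundedP _ 0); apply: nearW => i; rewrite mdistxx. Qed.

Lemma uclass_point : uclass (fun i => point) = ultralim_pt omega X.
Proof.
rewrite /uclass; case: pselect => // h.
by rewrite /ultralim_pt; congr (\pi_UL _); exact: val_inj.
Qed.

Lemma ultralim_complete : nonprincipal omega -> sequentially_complete UL.
Proof.
move=> np F FF /cauchyP cF.
have /choice[z hz] n : exists z : UL, F (ball z (n.+1%:R^-1)) by exact: cF.
have /choice[x hx] n : exists x, ubounded x /\ z n = uclass x.
  by have [x bx ->] := uclass_surj (z n); exists x.
(* The radii add up because the balls around [z k] and [z l] both belong to [F], hence meet. *)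
pose P k l i := mdist (x k i) (x l i) < k.+1%:R^-1 + l.+1%:R^-1.
have hP k l : \forall i \near omega, P k l i.
  have [[bk zk] [bl zl]] := (hx k, hx l).
  apply: uclass_lt => //; rewrite -zk -zl.
  have [u [zku zlu]] := filter_ex (filterI (hz k) (hz l)).
  move: zku zlu; rewrite !ballEmdist /= => zku zlu.
  by rewrite (le_lt_trans (metric_triangle _ u _))// ltrD// metric_sym.
pose S n i := forall k l, (k <= n)%N -> (l <= n)%N -> P k l i.
have hS n : \forall i \near omega, S n i.
  have hB k : \forall i \near omega, forall l, (l <= n)%N -> P k l i.
    elim: n => [|n IH]; first by apply: filterS (hP k 0%N) => i + [].
    apply: filterS2 IH (hP k n.+1) => i h1 h2 l.
    by rewrite leq_eqVlt => /orP[/eqP->//|]; exact: h1.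
  have : \forall i \near omega,
      forall k, (k <= n)%N -> forall l, (l <= n)%N -> P k l i.
    have : forall m, \forall i \near omega,
        forall k, (k <= m)%N -> forall l, (l <= n)%N -> P k l i.
      elim=> [|m IH]; first by apply: filterS (hB 0%N) => i + [].
      apply: filterS2 IH (hB m.+1) => i h1 h2 k.
      by rewrite leq_eqVlt => /orP[/eqP->//|]; exact: h1.
    exact.
  by apply: filterS => i h k l kn ln; exact: h.
(* Diagonal argument: the limit takes at [i] the value of the term of index    *)
(* [N i], the last one up to which the Cauchy estimates hold at [i].           *)
pose N i := (\max_(n < i.+1 | `[< S n i >]) n)%N.
have NP k i : (k <= i)%N -> S k i -> (k <= N i)%N /\ S (N i) i.
  rewrite -ltnS => ki Ski; split.
    by apply: (@leq_bigmax_cond _ _ _ (Ordinal ki)); apply/asboolP.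
  rewrite /N; have [|j + ->] :=
    @eq_bigmax_cond _ [pred n : 'I_i.+1 | `[< S n i >]] (@nat_of_ord _).
    by apply/card_gt0P; exists (Ordinal ki); rewrite inE; exact: Ski.
  by rewrite inE.
pose y i := x (N i) i.
have xy k : \forall i \near omega, mdist (x k i) (y i) <= 2 * k.+1%:R^-1.
  apply: filterS2 (hS k) (nonprincipal_tail k np) => i Ski ki.
  have [kN SN] := NP _ _ ki Ski; apply: ltW.
  apply: lt_le_trans (SN k (N i) kN (leqnn _)) _.
  by rewrite mulr_natl mulr2n lerD2l lef_pV2 ?posrE// ler_nat.
have by_ : ubounded y.
  have [b0 _] := hx 0%N.
  have [r hr] : exists r : R, \forall i \near omega, mdist (x 0%N i) point <= r.
    have := uclass_lt b0 ubounded_point (ltr_pwDr ltr01 (lexx _)) => h.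
    exists (mdist (uclass (x 0%N)) (uclass (fun i => point)) + 1).
    by apply: filterS h => i /ltW.
  apply: (@uboundedP _ (2 * 1%:R^-1 + r)); apply: filterS2 hr (xy 0%N) => i h1 h2.
  by rewrite (le_trans (metric_triangle _ (x 0%N i) _))// lerD// metric_sym.
exists (uclass y); apply/cvg_ballP => e e0.
(* Two thirds of [e] pay for the distance [2/(k+1)] from [z k] to the limit, one third for the
   radius of the ball around [z k]. *)
have [k ke] : exists k, k.+1%:R^-1 < e / 3 by apply: invS_lt; rewrite divr_gt0.
apply: filterS (hz k) => u; rewrite !ballEmdist /=.
have [bk zk] := hx k; have := uclass_le bk by_ (xy k); rewrite -zk => h1 h2.
rewrite (le_lt_trans (metric_triangle _ (z k) _))// metric_sym.
rewrite (le_lt_trans (lerD h1 (ltW h2)))//.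
have -> : e = 2 * (e / 3) + e / 3 by field.
by rewrite ltrD// ltr_pM2l.
Qed.

End ultralimit_classes.

Arguments ubounded {R} omega {Uomega X} x.
Arguments uclass {R} omega {Uomega X} x.

(** * Closed subsets as pointed complete metric spaces *)

Section closed_subspaces.
Context (R : realType) (T : metricType R).

(* The parameters [Sp], [cS] and [cT] carry the data of the pointed complete  *)
(* structure.                                                                 *)
Record closed_subspace (S : set T) (p : T) (Sp : S p) (cS : closed S)
    (cT : sequentially_complete T) : Type :=
  ClosedSubspace { csval : T; _ : csval \in S }.
Arguments csval {S p Sp cS cT} _.

Context (S : set T) (p : T) (Sp : S p) (cS : closed S)
  (cT : sequentially_complete T).
Notation C := (closed_subspace Sp cS cT).

HB.instance Definition _ := [isSub for @csval S p Sp cS cT].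
HB.instance Definition _ := [Choice of C by <:].

Let cdist (x y : C) : R := mdist (csval x) (csval y).
Let cdistxx x : cdist x x = 0. Proof. exact: mdistxx. Qed.
Let cdist_positivity x y : cdist x y = 0 -> x = y.
Proof. by move=> /mdist_positivity h; exact: val_inj. Qed.
Let cdist_sym x y : cdist x y = cdist y x. Proof. exact: metric_sym. Qed.
Let cdist_triangle y x z : cdist x z <= cdist x y + cdist y z.
Proof. exact: metric_triangle. Qed.

HB.instance Definition _ := isMetric.Build R C cdistxx cdist_positivity
  cdist_sym cdist_triangle.
HB.instance Definition _ := isPointed.Build C (ClosedSubspace Sp cS cT (mem_set Sp)).

Lemma csvalP (x : C) : S (csval x).
Proof. exact: set_mem (valP x). Qed.

Lemma csval_surj z : S z -> exists x : C, csval x = z.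
Proof. by move=> /mem_set Sz; exists (ClosedSubspace Sp cS cT Sz). Qed.

Lemma csval_inj : injective (@csval S p Sp cS cT).
Proof. exact: val_inj. Qed.

Let ccomplete (F : set_system C) : ProperFilter F -> cauchy F -> cvg F.
Proof.
move=> PF /cauchyP cF; have PG : ProperFilter (csval @ F) by exact: fmap_proper_filter.
have [|z Fz] := cT PG.
  apply/cauchyP => e /cF[x Fx]; exists (csval x).
  suff : F (@csval S p Sp cS cT @^-1` ball (csval x) e) by [].
  apply: filterS Fx => y.
  by rewrite /= !ballEmdist.
have Sz : S z.
  move: cS => /metric_closedP; apply=> e e0.
  move/cvg_ballP : Fz => /(_ _ e0) /filter_ex[y].
  by rewrite ballEmdist => zy; exists (csval y) => //; exact: csvalP.
have [x xz] := csval_surj Sz; apply/cvg_ex; exists x; apply/cvg_ballP => e e0.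
move/cvg_ballP : Fz => /(_ _ e0); apply: filterS => y.
by rewrite !ballEmdist -xz.
Qed.

HB.instance Definition _ := Uniform_isComplete.Build C ccomplete.

End closed_subspaces.

Arguments csval {R T S p Sp cS cT} _.

(** * The limit space *)

Section sup_pushforward.
Local Open Scope ereal_scope.
Context (R : realType) d (T : measurableType d) (dS : nat -> measure_display)
  (S : forall i, measurableType (dS i))
  (mu : forall i, {measure set (S i) -> \bar R}) (f : forall i, S i -> T).
Arguments f : clear implicits.

(** The two proofs are arguments so that the measure structure can be attached to this function. *)
Definition sup_pushforward of (forall i, measurable_fun [set: S i] (f i))
    & (forall A, measurable A -> nondecreasing_seq (fun i => mu i (f i @^-1` A))) :=
  fun A : set T => ereal_sup (range (fun i => mu i (f i @^-1` A))).

Hypothesis mf : forall i, measurable_fun [set: S i] (f i).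
Hypothesis nd :
  forall A, measurable A -> nondecreasing_seq (fun i => mu i (f i @^-1` A)).
Notation M := (sup_pushforward mf nd).

Lemma sup_pushforward_ge i A : mu i (f i @^-1` A) <= M A.
Proof. by apply: ereal_sup_ubound; exists i. Qed.

Let M0 : M set0 = 0.
Proof.
apply/le_anti/andP; split.
  by apply: ge_ereal_sup => _ [i _ <-]; rewrite preimage_set0 measure0.
by apply: le_trans (sup_pushforward_ge 0%N _).
Qed.

Let M_ge0 A : 0 <= M A.
Proof. by apply: le_trans (sup_pushforward_ge 0%N _). Qed.

(** Monotonicity in [i] lets the supremum over the measures pass through finite sums, and two
    suprema commute. *)
Let M_sigma_additive : semi_sigma_additive M.
Proof.
move=> F mF tF mUF.
have mufF i : mu i (f i @^-1` \bigcup_n F n) =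
    ereal_sup (range (fun n => \sum_(0 <= k < n) mu i (f i @^-1` F k))).
  rewrite preimage_bigcup.
  have cF : (fun n => \sum_(0 <= k < n) mu i (f i @^-1` F k)) @ \oo
      --> mu i (\bigcup_n f i @^-1` F n).
    apply: measure_semi_sigma_additive.
    - by move=> k; rewrite -[X in measurable X]setTI; exact: mf.
    - apply/trivIsetP => /= a b _ _ ab; rewrite -preimage_setI.
      by move/trivIsetP : tF => /(_ _ _ _ _ ab) ->//; rewrite preimage_set0.
    - by rewrite -preimage_bigcup -[X in measurable X]setTI; exact: mf.
  rewrite -(cvg_lim _ cF)//; apply/cvg_lim => //.
  by apply: ereal_nondecreasing_cvgn; apply: ereal_nondecreasing_series.
suff -> : M (\bigcup_n F n) = ereal_sup (range (fun n => \sum_(0 <= k < n) M (F k))).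
  by apply: ereal_nondecreasing_cvgn; apply: ereal_nondecreasing_series.
apply/le_anti/andP; split.
  apply: ge_ereal_sup => _ [i _ <-]; rewrite mufF.
  apply: ge_ereal_sup => _ [n _ <-]; apply: le_ereal_sup_tmp.
  exists (\sum_(0 <= k < n) M (F k)); first by exists n.
  by apply: lee_sum => k _; exact: sup_pushforward_ge.
apply: ge_ereal_sup => _ [n _ <-].
have cn : (fun i => \sum_(0 <= k < n) mu i (f i @^-1` F k)) @ \oo
    --> \sum_(0 <= k < n) M (F k).
  apply: cvg_nnesum => k _; first exact: nearW.
  exact/ereal_nondecreasing_cvgn/nd.
apply: cvge_le cn; apply: nearW => i; apply: le_trans (sup_pushforward_ge i _).
by rewrite mufF; apply: ereal_sup_ubound; exists n.
Qed.

HB.instance Definition _ :=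
  isMeasure.Build d T R M M0 M_ge0 M_sigma_additive.

End sup_pushforward.

(** * Morphisms *)

Section morphisms.
Context (R : realType) (X Y : ppmms R).

Lemma morphism_preimage (f : X -> Y) (A : set (borel Y)) : is_morphism f ->
  measurable A -> measurable (f @^-1` A : set (borel X)).
Proof.
by move=> [mf _ _ _] mA; rewrite -(setTI (_ @^-1` _)); exact: mf.
Qed.

Lemma morphism_meas (f : X -> Y) (A : set (borel X)) (B : set (borel Y)) :
  is_morphism f -> measurable A -> measurable B ->
  (forall x, A x -> sptm X x -> B (f x)) -> (meas X A <= meas Y B)%E.
Proof.
move=> mf mA mB AB; have [_ _ _ /(_ B mB)] := mf; apply: le_trans.
apply: le_meas_spt => //; first exact: morphism_preimage.
by move=> x [Ax Sx]; exact: AB.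
Qed.

Lemma morphism_spt (f : X -> Y) x : is_morphism f -> sptm X x -> sptm Y (f x).
Proof.
move=> mf Sx r r0; apply: lt_le_trans (Sx r r0) _.
apply: (morphism_meas mf); [exact: ball_borel|exact: ball_borel|].
move=> y; rewrite !ballEmdist /= => xy Sy.
exact: le_lt_trans (morphism_lip mf Sx Sy) xy.
Qed.

End morphisms.

(** The preimage of the complement of an open [U] is closed within the support. Off the support [f]
    is constant, so it contains all or nothing of that part, depending on whether [c] lies in
    [U]. *)
Lemma lip_spt_measurable (R : realType) (X : ppmms R)
    (Y : completeMetricType R) (f : X -> Y) c :
  (forall x y, sptm X x -> sptm X y -> mdist (f x) (f y) <= mdist x y) ->
  (forall x, ~ sptm X x -> f x = c) ->
  measurable_fun [set: borel X] (f : borel X -> borel Y).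
Proof.
move=> lf fc.
apply: (@measurability _ _ (borel X) (borel Y) setT f (@open Y) erefl) => _ [U oU <-].
rewrite setTI.
have cF : closed (sptm X `&` f @^-1` (~` U)).
  apply/metric_closedP => x h.
  have Sx : sptm X x.
    move: (@spt_closed _ X) => /metric_closedP; apply => e /h[y [Sy _] xy].
    by exists y.
  split => //; move: (open_closedC oU) => /metric_closedP; apply => e /h[y [Sy Uy] xy].
  by exists (f y) => //; exact: le_lt_trans (lf _ _ Sx Sy) xy.
have -> : f @^-1` U = ~` ((sptm X `&` f @^-1` (~` U)) `|`
    (if c \in U then set0 else ~` sptm X)).
  apply/seteqP; split=> x.
    move=> Ux [[_ //]|]; case: ifP => // /negP cU Sx; apply: cU.
    by rewrite -(fc x)// inE.
  move=> h; have [Sx|Sx] := pselect (sptm X x).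
    by apply: contrapT => Ux; apply: h; left.
  rewrite /= fc//; apply: contrapT => Uc; apply: h; right.
  by rewrite memNset.
apply: measurableC; apply: measurableU; first exact: closed_borel.
by case: ifP => // _; apply: measurableC; exact: spt_borel.
Qed.


Lemma morphism_id (R : realType) (X : ppmms R) : is_morphism (@id X).
Proof. by split => //; exact: measurable_id. Qed.

Lemma morphism_comp (R : realType) (X Y Z : ppmms R) (f : X -> Y) (g : Y -> Z) :
  is_morphism f -> is_morphism g -> is_morphism (g \o f).
Proof.
move=> mf mg; split.
- apply: (measurableT_comp (morphism_borel mg)); exact: morphism_borel.
- by rewrite /= (morphism_point mf) (morphism_point mg).
- move=> x y Sx Sy /=.
  apply: le_trans (morphism_lip mg _ _) (morphism_lip mf Sx Sy); exact: morphism_spt.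
- move=> A mA; apply: le_trans (morphism_push mg mA).
  exact: (morphism_push mf (morphism_preimage mg mA)).
Qed.

(** * The limit of the system inside the ultralimit *)

Section limit_space.
Context (R : realType) (omega : set_system nat) {Uomega : UltraFilter omega}.
Context (X : nat -> ppmms R) (phi : forall i j : nat, X i -> X j).
Arguments phi : clear implicits.
Hypotheses (np : nonprincipal omega) (ds : is_direct_system phi).
Notation spt i := (sptm (X i)).
Notation UL := (ultralim omega X).

Lemma transition_morphism i j : (i <= j)%N -> is_morphism (phi i j).
Proof. by case: ds => h _ _; exact: h. Qed.

Lemma transition_id i x : spt i x -> phi i i x = x.
Proof. by case: ds => _ h _; exact: h. Qed.

Lemma transition_comp i j k x : (i <= j)%N -> (j <= k)%N -> spt i x ->
  phi i k x = phi j k (phi i j x).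
Proof. by case: ds => _ _ h ij jk; exact: h. Qed.

Lemma transition_spt i j x : (i <= j)%N -> spt i x -> spt j (phi i j x).
Proof. by move=> ij; apply: morphism_spt; exact: transition_morphism. Qed.

Lemma transition_point i j : (i <= j)%N -> phi i j point = point.
Proof. by move=> /transition_morphism[]. Qed.

Lemma transition_lip i j x y : (i <= j)%N -> spt i x -> spt i y ->
  mdist (phi i j x) (phi i j y) <= mdist x y.
Proof. by move=> /transition_morphism/morphism_lip; apply. Qed.

Lemma transition_ball i j (r : R) x : (i <= j)%N -> spt i x ->
  ball point r x -> ball point r (phi i j x).
Proof.
move=> ij Sx; rewrite !ballEmdist /= => xr; rewrite -(transition_point ij).
by apply: le_lt_trans xr; apply: transition_lip => //; exact: ppmms_point.
Qed.

Lemma orbit_bounded i x : spt i x -> ubounded omega (phi i ^~ x).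
Proof.
move=> Sx; apply: (@uboundedP _ _ _ _ _ (mdist x point)).
apply: filterS (nonprincipal_tail i np) => j ij.
by rewrite -(transition_point ij) transition_lip//; exact: ppmms_point.
Qed.

(** The indices [j < i], where [phi i j] is arbitrary, are negligible for [omega]. Off the support a
    constant value keeps the map Borel. *)
Definition emb i (x : X i) : UL :=
  if pselect (spt i x) then uclass omega (phi i ^~ x) else ultralim_pt omega X.
Arguments emb : clear implicits.

Lemma embE i x : spt i x -> emb i x = uclass omega (phi i ^~ x).
Proof. by rewrite /emb; case: pselect. Qed.

Lemma emb_out i x : ~ spt i x -> emb i x = ultralim_pt omega X.
Proof. by rewrite /emb; case: pselect. Qed.

Lemma emb_dist_le i j k x y : (i <= k)%N -> (j <= k)%N -> spt i x -> spt j y ->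
  mdist (emb i x) (emb j y) <= mdist (phi i k x) (phi j k y).
Proof.
move=> ik jk Sx Sy; rewrite !embE//.
apply: uclass_le; [exact: orbit_bounded|exact: orbit_bounded|].
apply: filterS (nonprincipal_tail k np) => l kl.
rewrite (transition_comp ik kl)// (transition_comp jk kl)//.
by apply: transition_lip => //; exact: transition_spt.
Qed.

Lemma emb_lip i x y : spt i x -> spt i y -> mdist (emb i x) (emb i y) <= mdist x y.
Proof.
move=> Sx Sy; have := emb_dist_le (leqnn i) (leqnn i) Sx Sy.
by rewrite !transition_id.
Qed.

Lemma emb_transition i j x : (i <= j)%N -> spt i x -> emb i x = emb j (phi i j x).
Proof.
move=> ij Sx; apply: mdist_positivity; apply/le_anti; rewrite mdist_ge0 andbT.
have Sy := transition_spt ij Sx.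
apply: le_trans (emb_dist_le ij (leqnn j) Sx Sy) _.
by rewrite transition_id// mdistxx.
Qed.

Lemma emb_point i : emb i point = ultralim_pt omega X.
Proof.
rewrite embE; last exact: ppmms_point.
rewrite -(@uclass_point _ omega _ X).
apply: mdist_positivity; apply/le_anti; rewrite mdist_ge0 andbT.
apply: uclass_le; [exact/orbit_bounded/ppmms_point|exact: ubounded_point|].
apply: filterS (nonprincipal_tail i np) => j ij.
by rewrite transition_point// mdistxx.
Qed.

(** A bound valid almost everywhere is attained at some stage beyond [i] and [j]: this turns
    information on the limit into information on a single [X k]. *)
Lemma emb_dist_lt i j x y (r : R) : spt i x -> spt j y ->
  mdist (emb i x) (emb j y) < r ->
  exists k, [/\ (i <= k)%N, (j <= k)%N & mdist (phi i k x) (phi j k y) < r].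
Proof.
move=> Sx Sy; rewrite !embE// => /uclass_lt h.
have [k [[ik jk] kr]] := filter_ex (filterI (filterI (nonprincipal_tail i np)
  (nonprincipal_tail j np)) (h (orbit_bounded Sx) (orbit_bounded Sy))).
by exists k.
Qed.

Definition limit_set : set UL :=
  closure [set z | exists i, exists2 x, spt i x & z = emb i x].

Lemma emb_limit_set i x : limit_set (emb i x).
Proof.
apply: subset_closure; have [Sx|nSx] := pselect (spt i x); first by exists i, x.
by exists i, point; [exact: ppmms_point|rewrite emb_out// emb_point].
Qed.

Lemma limit_set_pt : limit_set (ultralim_pt omega X).
Proof. by rewrite -(emb_point 0%N); exact: emb_limit_set. Qed.

Definition limit_space := closed_subspace limit_set_pt
  (@closed_closure _ _ : closed limit_set) (ultralim_complete np).

HB.instance Definition _ := CompleteMetric.on limit_space.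

Definition limit_inj i (x : X i) : limit_space :=
  ClosedSubspace _ _ _ (mem_set (@emb_limit_set i x)).
Arguments limit_inj : clear implicits.

Lemma limit_inj_transition i j x : (i <= j)%N -> spt i x ->
  limit_inj i x = limit_inj j (phi i j x).
Proof. by move=> ij Sx; apply: csval_inj; exact: emb_transition. Qed.

Lemma limit_inj_point i : limit_inj i point = point.
Proof. by apply: csval_inj; exact: emb_point. Qed.

Lemma limit_inj_dense (z : limit_space) (e : R) : 0 < e ->
  exists i, exists2 x, spt i x & mdist z (limit_inj i x) < e.
Proof.
move=> e0; have cz : limit_set (csval z) := csvalP z.
have [y [i [x Sx yE]]] := (@metric_closureP R UL _ (csval z)).1 cz e e0.
by rewrite yE => zx; exists i, x.
Qed.

Lemma limit_inj_lip i x y : spt i x -> spt i y ->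
  mdist (limit_inj i x) (limit_inj i y) <= mdist x y.
Proof. exact: emb_lip. Qed.

Lemma limit_inj_dist_lt i j x y (r : R) : spt i x -> spt j y ->
  mdist (limit_inj i x) (limit_inj j y) < r ->
  exists k, [/\ (i <= k)%N, (j <= k)%N & mdist (phi i k x) (phi j k y) < r].
Proof. exact: emb_dist_lt. Qed.

Lemma limit_inj_measurable i :
  measurable_fun [set: borel (X i)] (limit_inj i : borel (X i) -> borel limit_space).
Proof.
apply: (@lip_spt_measurable _ _ _ _ point); first exact: limit_inj_lip.
by move=> x nS; apply: csval_inj; exact: emb_out.
Qed.

Lemma limit_inj_preimage i (A : set (borel limit_space)) : measurable A ->
  measurable (limit_inj i @^-1` A : set (borel (X i))).
Proof. by move=> mA; rewrite -(setTI (_ @^-1` _)); exact: limit_inj_measurable. Qed.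

Lemma limit_inj_meas_nd (A : set (borel limit_space)) : measurable A ->
  nondecreasing_seq (fun i => meas (X i) (limit_inj i @^-1` A)).
Proof.
move=> mA i j ij; apply: (morphism_meas (transition_morphism ij)).
- exact: limit_inj_preimage.
- exact: limit_inj_preimage.
- by move=> x /= Ax Sx; rewrite -limit_inj_transition.
Qed.

Definition limit_meas := sup_pushforward limit_inj_measurable limit_inj_meas_nd.

Lemma ball_meas_nd (r : R) :
  nondecreasing_seq (fun i => meas (X i) (ball (point : X i) r)).
Proof.
move=> i j ij; apply: (morphism_meas (transition_morphism ij)).
- exact: ball_borel.
- exact: ball_borel.
- by move=> x xr Sx; exact: transition_ball.
Qed.

(** A support point of [X i] whose image lies in the open ball of the limit enters the ball of
    radius [r] at some stage [i + n]. The sets [G n] of points that have entered increase, and the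
    transition map bounds the volume of each by that of a ball of [X (i + n)]. *)
Lemma limit_meas_ball_le (r : R) :
  (limit_meas (ball (point : limit_space) r)
     <= ereal_sup (range (fun i => meas (X i) (ball (point : X i) r))))%E.
Proof.
apply: ge_ereal_sup => _ [i _ <-].
pose G n : set (borel (X i)) :=
  spt i `&` phi i (i + n)%N @^-1` ball (point : X (i + n)%N) r.
have mG n : measurable (G n).
  apply: measurableI; first exact: spt_borel.
  apply: (morphism_preimage (transition_morphism (leq_addr n i))).
  exact: ball_borel.
have mUG : measurable (\bigcup_n G n) by exact: bigcupT_measurable.
apply: (@le_trans _ _ (meas (X i) (\bigcup_n G n))).
  apply: le_meas_spt => //; first by apply: limit_inj_preimage; exact: ball_borel.
  move=> x [/= + Sx]; rewrite ballEmdist /= -(limit_inj_point i) => h.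
  have [k [ik _]] := limit_inj_dist_lt (ppmms_point (X i)) Sx h.
  rewrite transition_point// => kr; exists (k - i)%N => //; split => //.
  by rewrite /= subnKC// ballEmdist.
have cG : meas (X i) \o G @ \oo --> meas (X i) (\bigcup_n G n).
  apply: nondecreasing_cvg_mu => // a b ab; apply/subsetPset => x [Sx].
  have ab' : (i + a <= i + b)%N by rewrite leq_add2l.
  move=> xr; split => //; rewrite /= (transition_comp (leq_addr a i) ab')//.
  by apply: transition_ball => //; apply: transition_spt => //; exact: leq_addr.
apply: cvge_le cG; apply: nearW => n; apply: le_ereal_sup_tmp.
exists (meas (X (i + n)%N) (ball (point : X (i + n)%N) r)); first by exists (i + n)%N.
apply: (morphism_meas (transition_morphism (leq_addr n i))) => //.
  exact: ball_borel.
by move=> x [].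
Qed.

(** Every point is close to the image of a support point, and the support part of a small ball
    around the latter is mapped into the given ball. *)
Lemma limit_meas_gt0 (z : limit_space) (r : R) : 0 < r -> (0 < limit_meas (ball z r))%E.
Proof.
move=> r0; have r20 : 0 < r / 2 by rewrite divr_gt0.
have [i [x Sx zx]] := limit_inj_dense z r20.
apply: lt_le_trans (sup_pushforward_ge _ _ i _).
apply: lt_le_trans (Sx _ r20) _; apply: le_meas_spt.
- exact: ball_borel.
- by apply: limit_inj_preimage; exact: ball_borel.
- move=> y [+ Sy]; rewrite /= !ballEmdist /= => xy.
  rewrite (le_lt_trans (metric_triangle _ (limit_inj i x) _))// (splitr r) ltrD//.
  exact: le_lt_trans (limit_inj_lip Sx Sy) xy.
Qed.

Lemma limit_space_separable : exists2 D : set limit_space, countable D & dense D.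
Proof.
pose ht0 i := cid (@dense_seq _ (X i) (spt i) point (ppmms_point (X i))).
pose t i := projT1 (ht0 i).
have ht i : _ := projT2 (ht0 i).
exists (range (fun k : nat * nat => limit_inj k.1 (t k.1 k.2))).
  exact: sub_countable (card_image_le _ _) (countableP _).
move=> O [z Oz] /metric_openP /(_ _ Oz)[e e0 zO].
have e20 : 0 < e / 2 by rewrite divr_gt0.
have [i [x Sx zx]] := limit_inj_dense z e20.
have [tS /(_ x _ Sx e20)[n xn]] := ht i.
exists (limit_inj i (t i n)); split; last by exists (i, n).
apply: zO; rewrite ballEmdist /=.
rewrite (le_lt_trans (metric_triangle _ (limit_inj i x) _))// (splitr e) ltrD//.
exact: le_lt_trans (limit_inj_lip Sx (tS n)) xn.
Qed.

Section finite.
Hypothesis ub : unif_bdd_finite omega X.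

(** The bound holds on an element of [omega], hence at arbitrarily late stages, and the volumes
    increase with the stage. *)
Lemma sup_ball_meas_lty (r : R) :
  (ereal_sup (range (fun i => meas (X i) (ball (point : X i) r))) < +oo)%E.
Proof.
have [s [s0 rs]] : exists s : R, 0 < s /\ r <= s.
  by exists (`|r| + 1); split; [rewrite ltr_wpDl|rewrite (le_trans (ler_norm r))// lerDl].
have [eta heta] := ub s0; apply: (@le_lt_trans _ _ eta%:E); last exact: ltry.
apply: ge_ereal_sup => _ [i _ <-].
have [k [ik hk]] := filter_ex (filterI (nonprincipal_tail i np) heta).
apply: le_trans hk; apply: le_trans (ball_meas_nd s ik).
by apply: le_meas; [exact: ball_borel|exact: ball_borel|exact: le_ball].
Qed.

Lemma limit_meas_lty (z : limit_space) (r : R) : (limit_meas (ball z r) < +oo)%E.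
Proof.
apply: le_lt_trans (sup_ball_meas_lty (mdist point z + r)).
apply: le_trans (limit_meas_ball_le _); apply: le_measure; rewrite ?inE.
- by apply: open_borel; exact: metric_ball_open.
- by apply: open_borel; exact: metric_ball_open.
- move=> y; rewrite !ballEmdist /= => zy.
  by rewrite (le_lt_trans (metric_triangle _ z _))// ltrD2l.
Qed.

Definition limit_ppmms : ppmms R := @PPMMS R limit_space limit_meas
  limit_space_separable limit_meas_lty (limit_meas_gt0 point).

Lemma limit_spt (z : limit_ppmms) : sptm limit_ppmms z.
Proof. exact: limit_meas_gt0. Qed.

Lemma limit_inj_morphism i : is_morphism (limit_inj i : X i -> limit_ppmms).
Proof.
split.
- exact: limit_inj_measurable.
- exact: limit_inj_point.
- exact: limit_inj_lip.
- by move=> A mA; exact: sup_pushforward_ge.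
Qed.

Lemma limit_inj_target : is_target phi (limit_inj : forall i, X i -> limit_ppmms).
Proof.
split; first exact: limit_inj_morphism.
by move=> i j ij x Sx; exact: limit_inj_transition.
Qed.

End finite.
End limit_space.

(** * The measure of the ultralimit *)

Section ultralimit_measure.
Context (R : realType) (omega : set_system nat) {Uomega : UltraFilter omega}.
Context (X : nat -> ppmms R) (phi : forall i j : nat, X i -> X j).
Arguments phi : clear implicits.
Hypotheses (np : nonprincipal omega) (ds : is_direct_system phi).
Hypothesis ub : unif_bdd_finite omega X.
Notation spt i := (sptm (X i)).
Notation UL := (ultralim omega X).
Notation emb i := (@emb _ omega _ X phi i).
Notation limit_inj i := (@limit_inj _ omega _ X phi np ds i).
Notation Z := (limit_ppmms np ds ub).

Lemma compact_ultra_lim (T : metricType R) (K : set T) (k : nat -> T) :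
  compact K -> (\forall j \near omega, K (k j)) ->
  exists2 x, K x & forall e : R, 0 < e -> \forall j \near omega, mdist (k j) x < e.
Proof.
move=> cK Kk; have [x [Kx clx]] := cK (k @ omega) _ Kk.
exists x => // e e0.
have [//|far] := in_ultra_setVsetC [set j | mdist (k j) x < e] Uomega.
have := clx [set y | ~ mdist y x < e] (ball x e) far (nbhsx_ballx x e e0).
by move=> [y [/= yx]]; rewrite ballEmdist /= metric_sym.
Qed.

(** The sequence [k] converges along [omega] to some [x] in [K]. As each [phi i j] is 1-Lipschitz on
    [K], the family [phi i j (k j)] has the class of the orbit of [x]. *)
Lemma orbit_limit i (K : set (X i)) (k : nat -> X i) (a : Otype omega X) :
  compact K -> K `<=` spt i -> (\forall j \near omega, K (k j)) ->
  (\forall j \near omega, repr (val a) j = phi i j (k j)) ->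
  exists2 x, K x & \pi_UL a = emb i x.
Proof.
move=> cK KS Kk ak; have [x Kx kx] := compact_ultra_lim cK Kk.
have Sx := KS _ Kx.
exists x => //; rewrite embE//; have [bx ->] := uclass_repr a.
have bo : ubounded omega (phi i ^~ x) by exact: orbit_bounded.
apply: mdist_positivity; apply/le_anti; rewrite mdist_ge0 andbT.
apply/ler_addgt0Pl => e e0; rewrite addr0; apply: uclass_le => //.
apply: filterS2 (filterI (nonprincipal_tail i np) ak) (filterI Kk (kx _ e0)).
move=> j [ij ->] [Kj kjx]; apply: le_trans (ltW kjx).
by apply: (transition_lip ds ij) => //; exact: KS.
Qed.

(** Here [h] and [y] stand for the uncovered and covered volumes of a ball in a late [X j], [b] for
    their sum, [c] for the volume of the ball of [X i], and [eta] for the supremum of these ball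
    volumes. One error [t] comes from [c] being below [eta], the other from the part of [c] missed
    by the compacts. *)
Lemma uncovered_volume_le (h y b c eta : \bar R) (t : R) :
  (0 <= h)%E -> (0 <= y)%E -> (b <= eta)%E -> b = (h + y)%E ->
  (c <= y + t%:E)%E -> (eta - t%:E < c)%E -> (eta < +oo)%E -> (h <= (t + t)%:E)%E.
Proof.
move=> h0 y0 be bE cy etac etaoo; move: be h0 y0 cy; rewrite {}bE {b}.
have pinfty : (+oo <= eta)%E -> False by rewrite leye_eq => /eqP e; rewrite e in etaoo.
case: h => [h| |] //; case: y => [y| |] // be _ _ cy; try by case: (pinfty be).
case: eta be etac etaoo {pinfty} => [eta| |] // be etac _.
case: c cy etac => [c| |] // cy etac.
move: be cy etac; rewrite -EFinN -!EFinD !lee_fin lte_fin; lra.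
Qed.

Section preimage.
Variable S : set UL.
Hypothesis mS : forall i, measurable (emb i @^-1` S : set (borel (X i))).

Definition trace_set (r : R) i : set (X i) := emb i @^-1` S `&` ball point r.
Arguments trace_set : clear implicits.

Lemma trace_set_measurable r i : measurable (trace_set r i : set (borel (X i))).
Proof. by apply: measurableI => //; exact: ball_borel. Qed.

Lemma trace_set_family r : ball_family omega (trace_set r).
Proof. by apply/ball_familyP; apply: nearW => i; exact: trace_set_measurable. Qed.

(* Up to a set of small volume a bounded sequence lies in the transported     *)
(* compact [phi i j @` K], where [K] is the union of two compacts on which    *)
(* [emb i] is in [S], resp. outside of [S]; by compactness such a sequence    *)
(* converges to a point of [emb i @` K].                                      *)
Lemma trace_set_approximates : approximates (ultralim_preimage S)
  (fun r => uprod (trace_set r) `&` Obar omega X).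
Proof.
move=> r r0; split; first exact/algO_uprod/trace_set_family.
move=> e e0; pose t := e / 3; have t0 : 0 < t by rewrite divr_gt0.
pose eta : \bar R := ereal_sup (range (fun i => meas (X i) (ball (point : X i) r))).
have etaoo : (eta < +oo)%E by exact: (sup_ball_meas_lty np ds ub).
have eta_ge j : (meas (X j) (ball (point : X j) r) <= eta)%E.
  by apply: ereal_sup_ubound; exists j.
have etafin : eta \is a fin_num.
  by rewrite ge0_fin_numE//; apply: le_trans (eta_ge 0%N).
(* This stage stays fixed: its ball has volume within [t] of the supremum, so later balls have
   little volume outside of its image. *)
have [_ [i _ <-] hi] := ub_ereal_sup_adherent t0 etafin.
have mB : measurable (ball (point : X i) r : set (borel (X i))) by exact: ball_borel.
have [C [C' [[cC cC'] CS CS' hC]]] :=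
  borel_inner_regular (@mS i) mB (ppmms_finite point r) t0.
(* Cutting by the support makes [phi i j] Lipschitz, hence continuous, on the compacts. *)
have cKC : compact (C `&` spt i : set (X i))
  by exact: compact_closedI cC (@spt_closed _ _).
have cKC' : compact (C' `&` spt i : set (X i))
  by exact: compact_closedI cC' (@spt_closed _ _).
pose K : set (X i) := (C `&` spt i) `|` (C' `&` spt i).
have cK : compact K by exact: compactU.
have mK : measurable (K : set (borel (X i))) by exact: compact_borel.
have KS : K `<=` spt i by move=> x [[]|[]].
have mphiK j : (i <= j)%N -> measurable (phi i j @` K : set (borel (X j))).
  move=> ij; apply: compact_borel; apply: continuous_compact cK.
  by apply: lip_within_continuous => x y /KS Sx /KS Sy; exact: transition_lip.
pose H j : set (X j) := ball point r `\` phi i j @` K.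
have bH : ball_family omega H.
  apply/ball_familyP; apply: filterS (nonprincipal_tail i np) => j /mphiK mj.
  by apply: measurableD => //; exact: ball_borel.
exists (uprod H `&` Obar omega X); split; first exact: algO_uprod.
- move=> a Na.
  have [Oa ra] : Obar omega X a /\ \forall j \near omega, ball point r (repr a j).
    case: Na => -[[]]; last by move=> h ? _; split => //; apply: filterS h => j [].
    by move=> [b _ <-] ? _; split => //; exact: set_mem (svalP b).
  split=> //; have [//|nH] := in_ultra_setVsetC [set j | H j (repr a j)] Uomega.
  exfalso.
  have aK : \forall j \near omega, exists2 x, K x & phi i j x = repr a j.
    apply: filterS2 ra nH => j rj nHj; apply: contrapT => nK; apply: nHj.
    by split => // -[x Kx xE]; apply: nK; exists x.
  pose P j x := K x /\ phi i j x = repr a j.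
  pose k j := xget point (P j).
  have kP : \forall j \near omega, P j (k j).
    apply: filterS aK => j [x Kx xE]; rewrite /k.
    by case: xgetP => [_ -> //|/(_ x) []].
  pose a' : Otype omega X := exist _ a (mem_set Oa).
  have ak : \forall j \near omega, repr (val a') j = phi i j (k j).
    by apply: filterS kP => j [_ ->].
  have embk : \forall j \near omega, emb j (repr a j) = emb i (k j).
    apply: filterS2 (nonprincipal_tail i np) kP => j ij [/KS Sk <-].
    by rewrite -emb_transition.
  have preimE : ultralim_preimage S a <-> S (\pi_UL a').
    split=> [[b Sb ba]|Sa]; last by exists a'.
    by rewrite (_ : a' = b)//; exact: val_inj.
  (* The ultrafilter decides which compact contains the sequence [k]. Either way the limit point and
     the terms lie on the same side of [S], contradicting [Na]. *)
  have [kC|kC] := in_ultra_setVsetC [set j | (C `&` spt i) (k j)] Uomega.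
    have [x [Cx _] ax] := orbit_limit cKC (@subIsetr _ _ _) kC ak.
    have SA : ultralim_preimage S a by apply/preimE; rewrite ax; exact: CS.
    case: Na => -[h]; last by case.
    apply; split => //.
    by apply: filterS3 kC embk ra => j [/CS Sk _] ek rj; split => //=; rewrite ek.
  have kC' : \forall j \near omega, (C' `&` spt i) (k j).
    by apply: filterS2 kP kC => j [[]].
  have [x [Cx _] ax] := orbit_limit cKC' (@subIsetr _ _ _) kC' ak.
  have nSA : ~ ultralim_preimage S a by move=> /preimE; rewrite ax; exact: CS'.
  case: Na => -[]; first by case.
  move=> [tr _] _; have [j [[[/= Sk _] ek] [/CS' nSk _]]] :=
    filter_ex (filterI (filterI tr embk) kC').
  by apply: nSk; rewrite /= -ek.
rewrite mbar0E//; rewrite (@fam_vol_bounded _ _ _ _ _ r); last first.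
  by apply: nearW => j x [].
apply: (@le_lt_trans _ _ (t + t)%:E); last by rewrite lte_fin /t; lra.
apply: lime_le; first exact: ultra_cvg_ereal.
apply: filterS (nonprincipal_tail i np) => j ij.
have mBj : measurable (ball (point : X j) r : set (borel (X j))) by exact: ball_borel.
have mBK : measurable (ball point r `&` phi i j @` K : set (borel (X j))).
  by apply: measurableI => //; exact: mphiK.
apply: (@uncovered_volume_le _ (meas (X j) (ball point r `&` phi i j @` K))
  (meas (X j) (ball point r)) (meas (X i) (ball point r)) eta) => //.
  exact: (measureDI (meas (X j)) mBj (mphiK _ ij)).
have mC : measurable (C `|` C') by apply: measurableU; exact: compact_borel.
rewrite (measureDI (meas (X i)) mB mC) addeC; apply: leeD => //.
apply: (morphism_meas (transition_morphism ds ij)) => //.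
  exact: measurableI.
move=> x [xr CC'] Sx; split; first exact: (transition_ball ds ij).
by exists x => //; case: CC' => ?; [left|right].
Qed.

Lemma trace_vol_nd r : nondecreasing_seq (fun i => meas (X i) (trace_set r i)).
Proof.
move=> i j ij; apply: (morphism_meas (transition_morphism ds ij)).
- exact: trace_set_measurable.
- exact: trace_set_measurable.
- move=> x [/= Sx xr] sx; split; first by rewrite /= -emb_transition.
  exact: (transition_ball ds ij).
Qed.

(** The approximation gives the measure as a limit in [r] of suprema over [i]; monotonicity in [r]
    makes it a double supremum, whose order can be exchanged. *)
Lemma mulimE : Bbar omega X (ultralim_preimage S) /\
  mulim omega X S = ereal_sup (range (fun i => meas (X i) (emb i @^-1` S))).
Proof.
split; first split.
- by move=> _ [a _ <-]; exact: set_mem (svalP a).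
- by exists (fun r => uprod (trace_set r) `&` Obar omega X); exact: trace_set_approximates.
pose v r := ereal_sup (range (fun i => meas (X i) (trace_set r i))).
have vE r : mbar0 (uprod (trace_set r) `&` Obar omega X) = v r.
  rewrite mbar0E; last exact: trace_set_family.
  rewrite (@fam_vol_bounded _ _ _ _ _ r); last by apply: nearW => j x [].
  exact: ultra_cvg_nondecreasing (trace_vol_nd r).
have trace_le r s i : r <= s ->
    (meas (X i) (trace_set r i) <= meas (X i) (trace_set s i))%E.
  move=> rs; apply: le_meas; [exact: trace_set_measurable|exact: trace_set_measurable|].
  by move=> x [Sx xr]; split => //; exact: le_ball xr.
rewrite /mulim (mbarE trace_set_approximates (l := ereal_sup (range v))).
  apply/le_anti/andP; split.
    apply: ge_ereal_sup => _ [r _ <-]; apply: ge_ereal_sup => _ [i _ <-].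
    apply: le_ereal_sup_tmp; exists (meas (X i) (emb i @^-1` S)); first by exists i.
    by apply: le_meas => //; [exact: trace_set_measurable|move=> x []].
  apply: ge_ereal_sup => _ [i _ <-].
  have UE : emb i @^-1` S = \bigcup_n trace_set n%:R i.
    apply/seteqP; split=> [x Sx|x [n _ []]//].
    exists (Num.bound (mdist point x)) => //; split => //.
    by rewrite ballEmdist /=; exact: archi_boundP (mdist_ge0 _ _).
  have : meas (X i) \o (fun n => trace_set n%:R i) @ \oo --> meas (X i) (emb i @^-1` S).
    rewrite UE; apply: nondecreasing_cvg_mu.
    - by move=> n; exact: trace_set_measurable.
    - by rewrite -UE.
    - move=> a b ab; apply/subsetPset => x [Sx xa]; split => //.
      by apply: le_ball xa; rewrite ler_nat.
  apply: cvge_le; apply: nearW => n; apply: le_ereal_sup_tmp.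
  exists (v n%:R); first by exists n%:R.
  by apply: ereal_sup_ubound; exists i.
under eq_fun do rewrite vE.
apply: nondecreasing_cvge => r s rs; apply: ge_ereal_sup => _ [i _ <-].
apply: le_ereal_sup_tmp; exists (meas (X i) (trace_set s i)); first by exists i.
exact: trace_le.
Qed.

End preimage.

Lemma limit_space_is_spt_ultralimit :
  is_spt_ultralimit (csval : Z -> ultralim omega X).
Proof.
have mball z (r : R) i : measurable (emb i @^-1` ball z r : set (borel (X i))).
  suff : measurable (limit_inj i @^-1` (csval @^-1` ball z r) : set (borel (X i))) by [].
  apply: limit_inj_preimage; apply: open_borel; apply/metric_openP => y.
  have /metric_openP o := @metric_ball_open _ UL z r; move=> /o[e e0 he].
  by exists e => // u; rewrite !ballEmdist /= => yu; apply: he; rewrite ballEmdist.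
(* A ball of the ultralimit has the measure of its trace on [Z]: positive around points of [Z], and
   zero when the ball misses [Z]. *)
have mulim_ball z r : mulim omega X (ball z r) = meas Z (csval @^-1` ball z r).
  by have [_ ->] := mulimE (mball z r).
split.
- apply/seteqP; split=> z.
    move=> [y _ <-] r r0; rewrite mulim_ball.
    apply: lt_le_trans (limit_meas_gt0 y r0) _; apply: le_measure; rewrite ?inE.
    + exact: ball_borel.
    + apply: open_borel; apply/metric_openP => u.
      have /metric_openP o := @metric_ball_open _ UL (csval y) r; move=> /o[e e0 he].
      by exists e => // w; rewrite !ballEmdist /= => yu; apply: he; rewrite ballEmdist.
    + by move=> u; rewrite !ballEmdist.
  move=> Sz; have [y yz] : exists y : Z, csval y = z; last by exists y.
  apply: csval_surj; apply: contrapT => nz.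
  have [r [r0 hr]] : exists r : R, 0 < r /\ forall y : Z, r <= mdist z (csval y).
    apply: contrapT => h; apply: nz; apply: (@closed_closure _ _).
    apply/(@metric_closureP R UL) => e e0; apply: contrapT => h'; apply: h.
    exists e; split => // y; rewrite leNgt; apply/negP => zy; apply: h'.
    by exists (csval y) => //; exact: csvalP.
  have := Sz r r0; rewrite mulim_ball (_ : csval @^-1` ball z r = set0) ?measure0 ?ltxx//.
  apply/seteqP; split=> // y; rewrite /= ballEmdist /= => zy.
  by have := hr y; rewrite leNgt zy.
- by [].
- move=> A mA.
  have AE i : emb i @^-1` (csval @` A) = limit_inj i @^-1` A.
    apply/seteqP; split=> x /=; last by move=> Ax; exists (limit_inj i x).
    by move=> [y Ay yx]; rewrite (_ : limit_inj i x = y)//; exact: csval_inj.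
  have mS i : measurable (emb i @^-1` (csval @` A) : set (borel (X i))).
    by rewrite AE; exact: limit_inj_preimage.
  have [hB ->] := mulimE mS; split => //.
  by congr ereal_sup; apply/seteqP; split=> _ [i _ <-]; exists i => //; rewrite AE.
- by [].
Qed.

End ultralimit_measure.

(** * Direct limits *)

Section direct_limits.
Context (R : realType) (X : nat -> ppmms R) (phi : forall i j : nat, X i -> X j).

(** Both [h] and the identity factor the cocone [f] through itself, so the universal property
    identifies them. *)
Lemma direct_limit_endo (Z : ppmms R) (f : forall i, X i -> Z) (h : Z -> Z) :
  is_direct_limit phi f -> is_morphism h ->
  (forall i, eq_mor (f i) (h \o f i)) -> eq_mor h id.
Proof.
move=> [tf uf] mh hf z Sz; have [T0 [_ _ uT]] := uf _ _ tf.
by rewrite (uT h mh hf z Sz) -(uT id (@morphism_id _ _) _ z Sz).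
Qed.

(** The two comparison morphisms are inverse to each other on supports; neither increases distances
    nor pushes measures above their targets, so both are preserved. *)
Lemma direct_limit_unique (Y Z : ppmms R) (g : forall i, X i -> Y)
    (f : forall i, X i -> Z) : is_direct_limit phi g -> is_direct_limit phi f ->
  exists Phi : Y -> Z,
    [/\ is_isomorphism Phi, forall i, eq_mor (f i) (Phi \o g i) &
        forall Phi' : Y -> Z, is_isomorphism Phi' ->
          (forall i, eq_mor (f i) (Phi' \o g i)) -> eq_mor Phi' Phi].
Proof.
move=> dg df; have [[tg ug] [tf uf]] := (dg, df).
have [Phi [mPhi fPhi uPhi]] := ug _ _ tf; have [Psi [mPsi gPsi _]] := uf _ _ tg.
have PsiPhi : eq_mor (Psi \o Phi) id.
  apply: (direct_limit_endo dg (morphism_comp mPhi mPsi)) => i x Sx.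
  by rewrite /= -[Phi _](fPhi i x Sx); exact: gPsi.
have PhiPsi : eq_mor (Phi \o Psi) id.
  apply: (direct_limit_endo df (morphism_comp mPsi mPhi)) => i x Sx.
  by rewrite /= -[Psi _](gPsi i x Sx); exact: fPhi.
exists Phi; split => //; last by move=> Phi' [mPhi' _ _]; exact: uPhi.
split => //.
- move=> x y Sx Sy; apply/le_anti/andP; split; first exact: (morphism_lip mPhi).
  rewrite -{1}(PsiPhi x Sx) -{1}(PsiPhi y Sy).
  by apply: (morphism_lip mPsi); exact: morphism_spt.
- move=> A mA; apply/le_anti/andP; split; first exact: (morphism_push mPhi).
  apply: (morphism_meas mPsi) => //; first exact: morphism_preimage.
  by move=> z Az Sz; rewrite /preimage /= -[Phi _]/((Phi \o Psi) z) PhiPsi.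
Qed.

Lemma direct_limit_bdd_finite (omega : set_system nat) (Z : ppmms R)
    (f : forall i, X i -> Z) : Filter omega ->
  is_target phi f -> unif_bdd_finite omega X.
Proof.
move=> Fomega [mf _] r r0; exists (fine (meas Z (ball (point : Z) r))).
apply: nearW => i; rewrite fineK; last by rewrite ge0_fin_numE//; exact: ppmms_finite.
apply: (morphism_meas (mf i)); [exact: ball_borel|exact: ball_borel|].
move=> x; rewrite !ballEmdist /= -(morphism_point (mf i)) => xr Sx.
by apply: le_lt_trans xr; apply: (morphism_lip (mf i)) => //; exact: ppmms_point.
Qed.

End direct_limits.

(** * The universal property of the limit space *)

Section universal_property.
Context (R : realType) (omega : set_system nat) {Uomega : UltraFilter omega}.
Context (X : nat -> ppmms R) (phi : forall i j : nat, X i -> X j).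
Hypotheses (np : nonprincipal omega) (ds : is_direct_system phi).
Hypothesis ub : unif_bdd_finite omega X.
Notation spt i := (sptm (X i)).
Notation f i := (@limit_inj _ omega _ X phi np ds i).
Notation Z := (limit_ppmms np ds ub).

Section target.
Variables (Y : ppmms R) (psi : forall i, X i -> Y).
Arguments psi : clear implicits.
Hypothesis tpsi : is_target phi psi.

(** Images at distance below a given bound in the limit are so at some stage [k], where [psi k] is
    1-Lipschitz. *)
Lemma target_lip i j x y : spt i x -> spt j y ->
  mdist (psi i x) (psi j y) <= mdist (f i x) (f j y).
Proof.
move=> Sx Sy; apply/ler_addgt0Pl => e e0; have [mpsi cpsi] := tpsi.
have : mdist (f i x) (f j y) < e + mdist (f i x) (f j y) by rewrite ltrDr.
move=> /(limit_inj_dist_lt Sx Sy)[k [ik jk /ltW]]; apply: le_trans.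
rewrite (cpsi _ _ ik x Sx) (cpsi _ _ jk y Sy).
by apply: (morphism_lip (mpsi k)); exact: (transition_spt ds).
Qed.

(** The value at [z] is the limit of the values of the target maps at points whose images tend to
    [z]. The inequality against all [psi i x] pins it down and drives the Lipschitz bound, the
    factorization and the uniqueness below. *)
Lemma target_extension (z : Z) : exists y : Y, forall i x, spt i x ->
  mdist y (psi i x) <= mdist z (f i x).
Proof.
have /choice[u hu] n : exists p : {i : nat & X i},
    spt (projT1 p) (projT2 p) /\ mdist z (f (projT1 p) (projT2 p)) < n.+1%:R^-1.
  have n0 : 0 < n.+1%:R^-1 :> R by rewrite invr_gt0.
  by have [i [x Sx zx]] := limit_inj_dense z n0; exists (existT _ i x).
pose y n := psi (projT1 (u n)) (projT2 (u n)).
have /cauchy_cvg cy : cauchy (y @ \oo).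
  apply: cauchy_exP => e e0.
  have [k ke] : exists k, k.+1%:R^-1 < e / 2 by apply: invS_lt; rewrite divr_gt0.
  exists (y k); exists k => // n /= kn; rewrite ballEmdist /=.
  have [[Sk zk] [Sn zn]] := (hu k, hu n).
  apply: le_lt_trans (target_lip Sk Sn) _.
  apply: le_lt_trans (metric_triangle _ z _) _; rewrite metric_sym (splitr e).
  rewrite ltrD//; first exact: lt_trans zk _.
  apply: lt_trans zn _; apply: le_lt_trans ke.
  by rewrite lef_pV2 ?posrE// ler_nat.
exists (lim (y @ \oo)) => i x Sx; apply/ler_addgt0Pl => e e0.
have e20 : 0 < e / 2 by rewrite divr_gt0.
have [k ke] := invS_lt e20.
have /cvg_ballP/(_ _ e20) hy := cy.
have [n [kn yn]] := filter_ex (filterI (nbhs_infty_ge k) hy).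
move: yn; rewrite ballEmdist /= => yn.
have [Sn zn] := hu n.
apply: le_trans (metric_triangle _ (y n) _) _.
rewrite {1}(splitr e) -addrA; apply: lerD; first exact: ltW.
apply: le_trans (target_lip Sn Sx) _.
apply: le_trans (metric_triangle _ z _) _; rewrite lerD2r metric_sym.
apply: ltW; apply: lt_trans zn _; apply: le_lt_trans ke.
by rewrite lef_pV2 ?posrE// ler_nat.
Qed.

Lemma target_factorization : exists Phi : Z -> Y,
  [/\ is_morphism Phi, forall i, eq_mor (psi i) (Phi \o f i) &
      forall Phi' : Z -> Y, is_morphism Phi' ->
        (forall i, eq_mor (psi i) (Phi' \o f i)) -> eq_mor Phi' Phi].
Proof.
have /choice[Phi hPhi] := target_extension; have [mpsi _] := tpsi.
have PhiE i x : spt i x -> psi i x = Phi (f i x).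
  move=> Sx; apply/esym/mdist_positivity/le_anti; rewrite mdist_ge0 andbT.
  by have := hPhi (f i x) i x Sx; rewrite mdistxx.
have Phi_lip z z' : mdist (Phi z) (Phi z') <= mdist z z'.
  apply/ler_addgt0Pl => e e0; have e20 : 0 < e / 2 by rewrite divr_gt0.
  have [i [x Sx zx]] := limit_inj_dense z' e20.
  apply: le_trans (metric_triangle _ (psi i x) _) _.
  rewrite (metric_sym _ (Phi z')).
  apply: le_trans (lerD (hPhi z i x Sx) (hPhi z' i x Sx)) _.
  apply: le_trans (lerD (metric_triangle _ z' _) (lexx _)) _.
  rewrite -addrA addrC lerD2r (splitr e).
  by apply: lerD; exact: ltW.
have mPhi : measurable_fun [set: borel Z] (Phi : borel Z -> borel Y).
  apply: (@lip_spt_measurable _ Z Y _ point) => [z z' _ _|z []]; first exact: Phi_lip.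
  exact: limit_spt.
exists Phi; split.
- split => //.
  + rewrite -(limit_inj_point np ds 0%N) -PhiE; last exact: ppmms_point.
    exact: (morphism_point (mpsi 0%N)).
  (* The measure of [Z] is a supremum of pushforwards, so each stage is bounded separately through
     [psi i]. *)
  + move=> A mA; apply: ge_ereal_sup => _ [i _ <-].
    apply: (morphism_meas (mpsi i)) => //.
      apply: limit_inj_preimage; rewrite -[_ @^-1` _]setTI.
      exact: mPhi.
    by move=> x Ax Sx; rewrite PhiE.
- by move=> i x Sx; exact: PhiE.
move=> Phi' mPhi' Phi'E z _.
apply: mdist_positivity; apply/le_anti; rewrite mdist_ge0 andbT.
apply/ler_addgt0Pl => e e0; have e20 : 0 < e / 2 by rewrite divr_gt0.
have [i [x Sx zx]] := limit_inj_dense z e20; rewrite addr0.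
apply: le_trans (metric_triangle _ (psi i x) _) _; rewrite (splitr e).
apply: lerD; last by rewrite metric_sym; exact: le_trans (hPhi z i x Sx) (ltW zx).
rewrite [psi i x](Phi'E i x Sx).
by apply: le_trans (morphism_lip mPhi' _ _) (ltW zx); exact: limit_spt.
Qed.

End target.

Lemma limit_space_direct_limit :
  is_direct_limit phi (fun i => f i : X i -> Z).
Proof.
by split; [exact: limit_inj_target|move=> Y psi; exact: target_factorization].
Qed.

End universal_property.

Theorem theorem14p1 (R : realType) (omega : set_system nat)
    (Uomega : UltraFilter omega) (X : nat -> ppmms R)
    (phi : forall i j : nat, X i -> X j) :
  nonprincipal omega ->
  is_direct_system phi ->
  ((exists (Z : ppmms R) (f : forall i, X i -> Z), is_direct_limit phi f)
     <-> unif_bdd_finite omega X) /\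
  (unif_bdd_finite omega X ->
   exists (Z : ppmms R) (iota : Z -> ultralim omega X),
     is_spt_ultralimit iota /\
     exists f : forall i, X i -> Z,
       is_direct_limit phi f /\
       forall (Y : ppmms R) (g : forall i, X i -> Y), is_direct_limit phi g ->
         exists Phi : Y -> Z,
           [/\ is_isomorphism Phi,
               forall i, eq_mor (f i) (Phi \o g i) &
               forall Phi' : Y -> Z, is_isomorphism Phi' ->
                 (forall i, eq_mor (f i) (Phi' \o g i)) -> eq_mor Phi' Phi]).
Proof.
move=> np ds; split.
  split=> [[Z [f [tf _]]]|ub]; first exact: (direct_limit_bdd_finite _ tf).
  by eexists; eexists; exact: (limit_space_direct_limit np ds ub).
move=> ub; exists (limit_ppmms np ds ub), csval.
split; first exact: limit_space_is_spt_ultralimit.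
have dl := limit_space_direct_limit (Uomega := Uomega) np ds ub.
eexists; split; first exact: dl.
by move=> Y g dg; exact: (direct_limit_unique dg dl).
Qed.
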